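(* Let $M,M'$ be regular indecomposable representations of $(T(n),\Omega)$ (or both of $(T(n),\sigma\Omega)$) and let $M\to M'$ be an irreducible map in the corresponding module category. Then $\iota(M')=\iota(M)-1$.
   Context: Let $k$ be a field and $n\ge 3$. $T(n)$ is the $n$-regular tree; fix a bipartite orientation $\Omega$ (every vertex a sink or a source) and let $\sigma\Omega$ be the opposite orientation. A module is a finite-dimensional $k$-representation of $(T(n),\Omega)$ or $(T(n),\sigma\Omega)$. The shift functor $\sigma$ is the composition of the Bernstein–Gelfand–Ponomarev reflection functors at all sinks (sending representations of $(T(n),\Omega)$ to those of $(T(n),\sigma\Omega)$ and vice versa), $\sigma^-$ its left adjoint, $\sigma^t=(\sigma^-)^{-t}$ for $t<0$. An indecomposable module $M$ is regular if $\sigma^tM\ne 0$ for all $t\in\mathbb Z$. The support $T(M)$ is the full subgraph of $T(n)$ on the vertices $a$ with $M_a\neq 0$; a diameter path is a path in $T(M)$ of maximal length $d(M)$, the radius is $r(M)=\lfloor d(M)/2\rfloor$; $M$ is a sink module if its diameter paths start and end at sinks of the orientation of its quiver. Fact: the shift orbit $\{\sigma^tM\}$ of a regular indecomposable $M$ contains a unique sink module $M_0$ of smallest radius. The index $\iota(M)$ is the integer $t$ with $M\cong\sigma^{t}M_0$. *)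

(* Defs.v *)
From HB Require Import structures.
From mathcomp Require Import all_boot all_order all_algebra.
Set Implicit Arguments. Unset Strict Implicit. Unset Printing Implicit Defensive.
Import GRing.Theory.
Local Open Scope ring_scope.

Section Tree.
Variable n : nat.

(* Vertices of T(n): reduced words in 'I_n (no two consecutive letters equal).
   The root is [::]; the neighbours of s are its parent and the reduced
   one-letter extensions rcons s i.  Every vertex has exactly n neighbours. *)
Definition reduced (s : seq 'I_n) : bool := sorted (fun x y : 'I_n => x != y) s.

Definition parent (s : seq 'I_n) : seq 'I_n := take (size s).-1 s.

Definition adj (x y : seq 'I_n) : bool :=
  [&& reduced x, reduced y &
      ((y != [::]) && (x == parent y)) || ((x != [::]) && (y == parent x))].

Definition nbrs (a : seq 'I_n) : seq (seq 'I_n) :=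
  (if a is [::] then [::] else [:: parent a])
    ++ [seq c <- [seq rcons a i | i <- enum 'I_n] | reduced c].

(* Orientations: o = false is Omega (vertices at even distance from the root
   are sinks), o = true is sigma Omega (the opposite orientation). *)
Definition sink (o : bool) (a : seq 'I_n) : bool := odd (size a) == o.

Definition arrow (o : bool) (x y : seq 'I_n) : bool := adj x y && sink o y.

End Tree.

Section Reps.
Variables (k : fieldType) (n : nat).

(* A k-representation: a vector space k^(rdim a) at each vertex, and for every
   pair (x,y) a linear map (row-vector convention, v |-> v *m rmap x y). *)
Record rep := Rep {
  rdim : seq 'I_n -> nat;
  rmap : forall x y : seq 'I_n, 'M[k]_(rdim x, rdim y) }.

Definition is_module (o : bool) (M : rep) : Prop :=
  [/\ forall a, rdim M a != 0%N -> reduced a,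
      exists s : seq (seq 'I_n), forall a, rdim M a != 0%N -> a \in s
    & forall x y, ~~ arrow o x y -> rmap M x y = 0].

Definition nonzero (M : rep) : Prop := exists a, rdim M a != 0%N.

Definition mor (M N : rep) := forall a, 'M[k]_(rdim M a, rdim N a).

Definition is_hom (o : bool) (M N : rep) (f : mor M N) : Prop :=
  forall x y, arrow o x y -> rmap M x y *m f y = f x *m rmap N x y.

Definition split_mono o (M N : rep) (f : mor M N) : Prop :=
  exists g : mor N M, is_hom o g /\ forall a, f a *m g a = 1%:M.

Definition split_epi o (M N : rep) (f : mor M N) : Prop :=
  exists g : mor N M, is_hom o g /\ forall a, g a *m f a = 1%:M.

Definition iso (o : bool) (M : rep) (o' : bool) (N : rep) : Prop :=
  o = o' /\ exists (f : mor M N) (g : mor N M),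
    [/\ is_hom o f, is_hom o g, forall a, f a *m g a = 1%:M
      & forall a, g a *m f a = 1%:M].

Definition indecomposable (o : bool) (M : rep) : Prop :=
  nonzero M /\
  forall e : mor M M, is_hom o e -> (forall a, e a *m e a = e a) ->
    (forall a, e a = 0) \/ (forall a, e a = 1%:M).

Definition irreducible (o : bool) (M N : rep) (f : mor M N) : Prop :=
  [/\ is_hom o f, ~ split_mono o f, ~ split_epi o f &
      forall (X : rep) (g : mor M X) (h : mor X N), is_module o X ->
        is_hom o g -> is_hom o h -> (forall a, f a = g a *m h a) ->
        split_mono o g \/ split_epi o h].

Section Shift.
Variables (o : bool) (M : rep).

Definition proj_nb (a y : seq 'I_n) :
  'M[k]_(\sum_(j < size (nbrs a)) rdim M (nth a (nbrs a) j), rdim M y) :=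
  @mxcol k (size (nbrs a)) (fun j => rdim M (nth a (nbrs a) j)) (rdim M y)
    (fun j => if (j : nat) == index y (nbrs a)
              then conform_mx 0 (1%:M : 'M[k]_(rdim M y)) else 0).

Definition inj_nb (a x : seq 'I_n) :
  'M[k]_(rdim M x, \sum_(j < size (nbrs a)) rdim M (nth a (nbrs a) j)) :=
  @mxrow k (size (nbrs a)) (fun j => rdim M (nth a (nbrs a) j)) (rdim M x)
    (fun j => if (j : nat) == index x (nbrs a)
              then conform_mx 0 (1%:M : 'M[k]_(rdim M x)) else 0).

Definition in_map (a : seq 'I_n) :
  'M[k]_(\sum_(j < size (nbrs a)) rdim M (nth a (nbrs a) j), rdim M a) :=
  @mxcol k (size (nbrs a)) (fun j => rdim M (nth a (nbrs a) j)) (rdim M a)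
    (fun j => rmap M (nth a (nbrs a) j) a).

Definition out_map (a : seq 'I_n) :
  'M[k]_(rdim M a, \sum_(j < size (nbrs a)) rdim M (nth a (nbrs a) j)) :=
  @mxrow k (size (nbrs a)) (fun j => rdim M (nth a (nbrs a) j)) (rdim M a)
    (fun j => rmap M a (nth a (nbrs a) j)).

(* sigma: reflection at all sinks of o (kernels); result lives on ~~ o *)
Definition sig_dim (a : seq 'I_n) : nat :=
  if sink o a && reduced a then \rank (kermx (in_map a)) else rdim M a.

Definition sig_map (x y : seq 'I_n) : 'M[k]_(sig_dim x, sig_dim y) :=
  if arrow (~~ o) x y
  then conform_mx 0 (row_base (kermx (in_map x)) *m proj_nb x y) else 0.

Definition sigma : rep := Rep sig_map.

(* sigma^- : reflection at all sources of o (cokernels); result lives on ~~ o *)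
Definition sigm_dim (a : seq 'I_n) : nat :=
  if ~~ sink o a && reduced a then \rank (cokermx (out_map a)) else rdim M a.

Definition sigm_map (x y : seq 'I_n) : 'M[k]_(sigm_dim x, sigm_dim y) :=
  if arrow (~~ o) x y
  then conform_mx 0 (inj_nb y x *m col_base (cokermx (out_map y))) else 0.

Definition sigmam : rep := Rep sigm_map.

End Shift.

Fixpoint sigN (m : nat) (o : bool) (M : rep) : rep :=
  if m is m'.+1 then sigma (iter m' negb o) (sigN m' o M) else M.

Fixpoint sigmN (m : nat) (o : bool) (M : rep) : rep :=
  if m is m'.+1 then sigmam (iter m' negb o) (sigmN m' o M) else M.

Definition sig_pow (o : bool) (t : int) (M : rep) : rep :=
  match t with
  | Posz m => sigN m o M
  | Negz m => sigmN m.+1 o M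
  end.

(* orientation of the quiver of sigma^t M when M lives on o *)
Definition orient (o : bool) (t : int) : bool := xorb o (odd `|t|%N).

Definition regular (o : bool) (M : rep) : Prop :=
  forall t : int, nonzero (sig_pow o t M).

Definition tpath (M : rep) (p : seq (seq 'I_n)) : bool :=
  [&& p != [::], uniq p, all (fun a => rdim M a != 0%N) p & sorted (@adj n) p].

(* d is the diameter d(M) (maximal length = number of edges of a path) *)
Definition is_diam (M : rep) (d : nat) : Prop :=
  (exists p, tpath M p /\ size p = d.+1) /\
  (forall p, tpath M p -> (size p <= d.+1)%N).

Definition has_radius (M : rep) (r : nat) : Prop :=
  exists d, is_diam M d /\ r = d./2.

Definition sink_module (o : bool) (M : rep) : Prop :=
  exists d, is_diam M d /\
    forall p, tpath M p -> size p = d.+1 ->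
      sink o (head [::] p) && sink o (last [::] p).

Definition index_is (o : bool) (M : rep) (t : int) : Prop :=
  exists s : int,
    let o0 := orient o s in
    let M0 := sig_pow o s M in
    [/\ sink_module o0 M0,
        exists r0, has_radius M0 r0 /\
          forall (s' : int) (r' : nat),
            sink_module (orient o s') (sig_pow o s' M) ->
            has_radius (sig_pow o s' M) r' -> (r0 <= r')%N
      & iso o M (orient o0 t) (sig_pow o0 t M0)].

End Reps.

(* Main.v *)
Require Import Defs.
From HB Require Import structures.
From mathcomp Require Import all_boot all_order all_algebra.
From mathcomp Require Import zify.
From Stdlib Require Import ClassicalEpsilon.
Set Implicit Arguments. Unset Strict Implicit. Unset Printing Implicit Defensive.
Import GRing.Theory.
Local Open Scope ring_scope.

(* Write T_i for the support of sigma^i M. Let s be the last i such that the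
   longest paths of T_i join sinks; then T_(s-j) is contained in the ball of
   radius r+j around a fixed center c and contains two boundary points at
   distance 2(r+j), the radius of a sink module of the orbit is minimal exactly
   at s, and index(M) = -s. So one must show s' = s+1 for an irreducible map
   M -> M' with last sink positions s and s'.

   The module sigma^2 C is the Auslander-Reiten translate of a regular
   indecomposable C: the separation of subspaces by trace forms yields an
   extension of C by sigma^2 C which is right, hence also left, almost split.
   Therefore M' is a summand of an extension of sigma^(-2) M by M, M is a summand
   of an extension of M' by sigma^2 M', and there is an irreducible map
   sigma^2 M' -> M. Moreover irreducible maps are mono or epi, and both
   irreducibility and monomorphisms are transported along the shift. Comparing
   centers and radii of the supports of M and M' with this information gives
   s' <= s+1 for every irreducible map; applied to sigma^2 M' -> M, whose source
   has last sink position s'-2, it gives s <= s'-1. *)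

(** * The metric of the tree *)

(** In [sig_pow] the positive powers are built from kernels, the negative ones from cokernels, and
    opposite shifts cancel only up to isomorphism. Cancellation is therefore never stated as an
    equality: consecutive modules are tied by the relation [half_link], which both functors satisfy,
    and an orbit is any family over the integers with linked neighbours. Supports of indecomposables
    are connected, so sink modules are recognised from dimensions alone; the geometric part sees an
    orbit only as a family of functions obeying the reflection formula, and an irreducible map only
    as inclusions of supports. The condition 3 <= n provides a neighbour leading away from a given
    centre, which makes the balls grow. The almost split extension comes from the locality of
    End(C): its nonunits form a subspace that misses 1, a linear form vanishes on them but not at 1,
    and a trace pairing turns this form into a cochain. The pairing is the Auslander-Reiten duality
    between Ext^1(X, sigma^2 C) and Hom(C, X). *)

Section TreeMetric.
Local Open Scope nat_scope.
Variable n : nat.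
Implicit Types (x y z c : seq 'I_n).

(** This is the Gromov product of two vertices based at the root, whence the ultrametric inequality
    [lcp_ultra]. *)
Fixpoint lcp x y : nat :=
  match x, y with
  | i :: x', j :: y' => if i == j then (lcp x' y').+1 else 0
  | _, _ => 0
  end.

Lemma lcpC x y : lcp x y = lcp y x.
Proof. by elim: x y => [|i x IH] [|j y] //=; rewrite eq_sym IH. Qed.

Lemma lcp_le x y : lcp x y <= size x.
Proof. by elim: x y => [|i x IH] [|j y] //=; case: eqP => // _; rewrite ltnS. Qed.

Lemma lcp_ultra x y z :
  minn (lcp x y) (lcp y z) <= lcp x z.
Proof.
elim: x y z => [|i x IH] [|j y] [|l z] //=; rewrite ?minn0 ?min0n //.
case: (eqVneq i j) => [->|]; last by rewrite min0n.
case: (eqVneq j l) => [_|]; last by rewrite minn0.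
by rewrite minnSS ltnS.
Qed.

Lemma lcp_sizel x y :
  (lcp x y == size x) = (x == take (size x) y).
Proof.
elim: x y => [|i x IH] [|j y] //=.
by rewrite eqseq_cons; case: (i =P j) => //= _; rewrite -IH.
Qed.

Lemma lcpxx x : lcp x x = size x.
Proof. by apply/eqP; rewrite lcp_sizel take_size. Qed.

(** The default [i0] of [nth] is arbitrary: the letter counts only when [size x < size c]. *)
Lemma lcp_rcons c x (i i0 : 'I_n) :
  lcp c (rcons x i) =
  lcp c x + [&& lcp c x == size x, size x < size c & nth i0 c (size x) == i].
Proof.
elim: x c => [|j x IH] [|l c] //=.
  by case: (l =P i) => //; case: (c).
by case: (l =P j) => //= _; rewrite IH.
Qed.

Definition dist x y : nat := size x + size y - 2 * lcp x y.

Lemma distC x y : dist x y = dist y x.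
Proof. by rewrite /dist lcpC addnC. Qed.

Lemma distxx x : dist x x = 0.
Proof. by rewrite /dist lcpxx; lia. Qed.

Lemma dist_eq0 x y : dist x y = 0 -> x = y.
Proof.
rewrite /dist => d0.
have := lcp_le x y; have := lcp_le y x; rewrite (lcpC y x) => h1 h2.
have : lcp x y == size x by lia.
have -> : (lcp x y == size x) = (x == y); last by move/eqP.
by rewrite lcp_sizel (_ : size x = size y) ?take_size //; lia.
Qed.

(** The four-point condition of a 0-hyperbolic space, obtained from [lcp_ultra]. It takes the place
    of branch points and midpoints of geodesics in the arguments on balls. *)
Lemma dist_four x y z w :
  dist x y + dist z w <= maxn (dist x z + dist y w) (dist x w + dist y z).
Proof.
have H : minn (lcp x z + lcp y w) (lcp x w + lcp y z) <= lcp x y + lcp z w.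
  move: (lcp_ultra x z y) (lcp_ultra x w y) (lcp_ultra z x w) (lcp_ultra z y w).
  rewrite (lcpC z y) (lcpC w y) (lcpC z x).
  move: (lcp x y) (lcp z w) (lcp x z) (lcp y w) (lcp x w) (lcp y z); lia.
rewrite /dist; move: H.
move: (lcp_le x y) (lcp_le y x) (lcp_le x z) (lcp_le z x) (lcp_le x w) (lcp_le w x).
move: (lcp_le y z) (lcp_le z y) (lcp_le y w) (lcp_le w y) (lcp_le z w) (lcp_le w z).
rewrite !(lcpC y x) !(lcpC z x) !(lcpC w x) !(lcpC z y) !(lcpC w y) !(lcpC w z).
move: (lcp x y) (lcp z w) (lcp x z) (lcp y w) (lcp x w) (lcp y z).
move: (size x) (size y) (size z) (size w) => a b c d; lia.
Qed.

Lemma dist_tri x y z : dist x z <= dist x y + dist y z.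
Proof. by have := dist_four x z y y; rewrite distxx (distC z y); lia. Qed.

Lemma odd_dist x y : odd (dist x y) = odd (size x) (+) odd (size y).
Proof.
have := lcp_le x y; have := lcp_le y x; rewrite /dist (lcpC y x) => h1 h2.
by rewrite oddB ?mul2n ?odd_double ?addbF ?oddD //; lia.
Qed.

Lemma parent_rcons x i : parent (rcons x i) = x.
Proof. by rewrite /parent size_rcons /= -cats1 take_size_cat. Qed.

Lemma adjC x y : adj x y = adj y x.
Proof. by rewrite /adj; case: (reduced x); case: (reduced y) => //=; rewrite orbC. Qed.

Lemma adj_rcons x y : adj x y ->
  exists i, (y = rcons x i) \/ (x = rcons y i).
Proof.
case/and3P=> _ _ /orP [] /andP [].
  by case/lastP: y => // y i _ /eqP ->; exists i; rewrite parent_rcons; left.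
by case/lastP: x => // x i _ /eqP ->; exists i; rewrite parent_rcons; right.
Qed.

Lemma adj_reduced x y : adj x y -> reduced x /\ reduced y.
Proof. by case/and3P. Qed.

Lemma odd_adj x y : adj x y -> odd (size y) = ~~ odd (size x).
Proof. by case/adj_rcons => i [->|->]; rewrite size_rcons /= ?negbK. Qed.

Lemma adj_dist c x y : adj x y ->
  dist c y = (dist c x).+1 \/ dist c x = (dist c y).+1.
Proof.
suff W z i : dist c (rcons z i) = (dist c z).+1 \/ dist c z = (dist c (rcons z i)).+1.
  by case/adj_rcons => i [->|->]; have [] := W x i; have [] := W y i; tauto.
rewrite /dist (lcp_rcons _ _ _ i) size_rcons; have := lcp_le c z; have := lcp_le z c.
rewrite (lcpC z c); set b := [&& _, _ & _]; case: (boolP b); last by lia.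
by case/and3P; lia.
Qed.

Lemma adj_dist1 x y : adj x y -> dist x y = 1.
Proof. by move/(adj_dist x); rewrite distxx; case=> //; lia. Qed.

Lemma mem_nbrs x y : reduced x -> (y \in nbrs x) = adj x y.
Proof.
move=> rx; rewrite /nbrs mem_cat mem_filter; apply/idP/idP.
  case/orP.
    case/lastP: x rx => // x i rx; case: (rcons x i) (parent_rcons x i) rx => [|a s] pE rx.
      by case: x {pE}.
    rewrite inE pE => /eqP ->; rewrite /adj rx /= pE eqxx orbT andbT.
    have: prefix x (a :: s) by rewrite -pE /parent; apply/prefixP; exists (drop (size (a :: s)).-1 (a :: s)); rewrite cat_take_drop.
    by case/prefixP=> t E; move: rx; rewrite E /reduced; case/cat_sorted2.
  case/andP=> ry /mapP [i _ E]; rewrite /adj rx ry /=; rewrite E parent_rcons eqxx.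
  by case: (x).
move=> axy; have [_ ry] := adj_reduced axy.
have [i [E|E]] := adj_rcons axy.
  by rewrite ry E map_f ?orbT // mem_enum.
rewrite E; case Ex: (rcons y i) => [|a s]; first by case: (y) Ex.
by rewrite inE -Ex parent_rcons eqxx.
Qed.

Lemma nbrs_uniq x : uniq (nbrs x).
Proof.
have u : uniq [seq c <- [seq rcons x i | i <- enum 'I_n] | reduced c].
  rewrite filter_uniq // map_inj_uniq ?enum_uniq //.
  by move=> i j /eqP; rewrite eqseq_rcons => /andP [_ /eqP].
rewrite /nbrs cat_uniq u andbT; case: x {u} => [|a s] /=.
  by rewrite -all_predC; apply/allP.
apply/hasPn => y; rewrite mem_filter => /andP [_ /mapP [i _ ->]].
rewrite inE; apply/negP => /eqP /(congr1 size).
by rewrite /= size_rcons /parent size_takel //=; lia.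
Qed.

Hypothesis n_ge3 : 2 < n.

(** Two letters are excluded: the last letter of [x], for reducedness, and the letter with which [c]
    may continue after [x], which would lead towards [c]. A third letter remains. *)
Lemma farther_nbr c x : reduced x -> exists2 y, adj x y & dist c y = (dist c x).+1.
Proof.
move=> rx; have i0 : 'I_n by apply: (Ordinal (ltnW (ltnW n_ge3))).
have [i [il ic]] : exists i : 'I_n, i != last i0 x /\ i != nth i0 c (size x).
  apply/not_all_not_ex => H; have: [set: 'I_n] \subset [set last i0 x; nth i0 c (size x)].
    apply/subsetP => i _; rewrite !inE; move: (H i).
    by case: eqP => //= _; case: eqP => //= _ []; split.
  move/subset_leq_card; rewrite cardsT card_ord cards2; case: eqP => /=; lia.
exists (rcons x i).
  rewrite /adj rx parent_rcons eqxx /=; apply/andP; split; last by case: (x).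
  move: rx il; case: (x) => [|a s] //= rx il.
  by rewrite /reduced /= rcons_path; rewrite -/(reduced (a :: s)) in rx; rewrite [path _ _ _]rx eq_sym.
rewrite /dist (lcp_rcons _ _ _ i0) size_rcons [nth _ _ _ == _]eq_sym (negbTE ic) !andbF addn0.
have := lcp_le c x; have := lcp_le x c; rewrite (lcpC x c); lia.
Qed.

End TreeMetric.

(** * Sink balls in shift orbits *)

Lemma orientS o (i : int) : orient o (i + 1) = ~~ orient o i.
Proof.
have -> : orient o (i + 1) = o (+) odd `|i + 1 : int|%N by case: o.
have -> : orient o i = o (+) odd `|i|%N by case: o.
by rewrite -addbN; congr (_ (+) _); lia.
Qed.

Section SinkBalls.
Variable n : nat.
Implicit Types (x y z c p q : seq 'I_n) (T : seq 'I_n -> nat).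

(** For a connected support: the diameter is 2r, [c] is the middle of a diameter path, and the
    parity condition makes the vertices at distance r from [c] sinks. The condition 0 < r excludes a
    one-point support. *)
Definition sink_ball o T c (r : nat) : Prop :=
  [/\ (0 < r)%N, odd (size c) (+) odd r = o,
      forall x, T x != 0%N -> (dist c x <= r)%N
    & exists p q, [/\ T p != 0%N, T q != 0%N, dist c p = r, dist c q = r
                    & dist p q = (2 * r)%N]].

(** Four-point condition for [c], [c'] and the two antipodal points [p], [q] at distance 2r. *)
Lemma sink_ball_sub o T c r c' r' : sink_ball o T c r ->
  (forall x, T x != 0%N -> (dist c' x <= r')%N) -> (dist c c' + r <= r')%N.
Proof.
case=> _ _ _ [p] [q] [Tp Tq cp cq pq] sub.
by have := (sub _ Tp); have := (sub _ Tq); have := dist_four c c' p q; lia.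
Qed.

Lemma sink_dist o c r x : odd (size c) (+) odd r = o ->
  sink o x = (odd (dist c x) == odd r).
Proof.
by rewrite /sink odd_dist => <-; case: (odd r); case: (odd _); case: (odd _).
Qed.

Lemma sink_adj o x y : adj x y -> sink o y = ~~ sink o x.
Proof. by move/odd_adj; rewrite /sink => ->; case: (odd _); case: o. Qed.

Lemma sinkN o x : sink (~~ o) x = ~~ sink o x.
Proof. by rewrite /sink; case: (odd _); case: o. Qed.

Variables (o : bool) (D : int -> seq 'I_n -> nat).

(** The numerical shadow of a shift orbit: sources keep their dimension, and at a sink rank and
    nullity of a surjection from the sum over the neighbours add up. *)
Definition dim_orbit : Prop :=
  [/\ forall i x, D i x != 0%N -> reduced x,
      forall i x, ~~ sink (orient o i) x -> D (i + 1) x = D i x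
    & forall i x, reduced x -> sink (orient o i) x ->
        (D (i + 1) x + D i x = \sum_(y <- nbrs x) D i y)%N].

Hypothesis orbD : dim_orbit.

Lemma dim_orbit_nbr i x : sink (orient o i) x ->
  (D (i + 1) x + D i x != 0)%N -> exists2 y, adj x y & D i y != 0%N.
Proof.
move=> sx nz; have [red _ eqS] := orbD.
have rx : reduced x.
  by move: nz; rewrite addn_eq0 negb_and => /orP [] /red.
move: nz; rewrite eqS //.
case: (boolP (has (fun y => D i y != 0%N) (nbrs x))) => [/hasP [y yx ny] _|].
  by exists y; rewrite // -mem_nbrs.
move=> /hasPn H; rewrite big_seq big1 //= => y /H; rewrite negbK => /eqP //.
Qed.

Lemma dim_orbit_pos i x y : sink (orient o i) x -> adj x y -> D i y != 0%N ->
  (D (i + 1) x + D i x != 0)%N.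
Proof.
move=> sx xy ny; have [_ _ eqS] := orbD; have [rx _] := adj_reduced xy.
rewrite eqS //; rewrite (big_rem y) ?mem_nbrs //=; move: ny; lia.
Qed.

(** The inverse shift enlarges the ball: a neighbour of [p] farther from [c] is a sink at [i] and
    has dimension zero at [i + 1], so the reflection formula makes its dimension at [i] nonzero. *)
Lemma sink_ball_prev (n_ge3 : (2 < n)%N) i c r : sink_ball (orient o (i + 1)) (D (i + 1)) c r ->
  sink_ball (orient o i) (D i) c r.+1.
Proof.
have [red eqD eqS] := orbD.
case=> r0 par sub [p] [q] [Tp Tq cp cq pq]; split=> //.
- by move: par; rewrite orientS /=; case: (odd _); case: (odd _); case: (orient _ _).
- move=> x nx; case: (boolP (sink (orient o i) x)) => sx.
    have [|y xy ny] := dim_orbit_nbr sx; first by move: nx; lia.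
    have sy : ~~ sink (orient o i) y by rewrite (sink_adj _ xy) sx.
    have := sub y; rewrite eqD // => /(_ ny); have := adj_dist c xy; lia.
  by apply: leqW; apply: sub; rewrite eqD.
- have far p0 : D (i + 1) p0 != 0%N -> dist c p0 = r ->
    exists2 p', adj p0 p' & D i p' != 0%N /\ dist c p' = r.+1.
    move=> np cp0; have [p' pp' cp'] := farther_nbr n_ge3 c (red _ _ np).
    have sp : sink (orient o i) p0 = false.
      by have := sink_dist p0 par; rewrite cp0 eqxx orientS sinkN => /negbTE.
    have sp' : sink (orient o i) p' by rewrite (sink_adj _ pp') sp.
    exists p' => //; split; last by rewrite cp' cp0.
    have p'p : adj p' p0 by rewrite adjC.
    have := dim_orbit_pos sp' p'p; rewrite -eqD ?sp // => /(_ np); case: (eqVneq (D (i + 1) p') 0%N) => [->|] //.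
    by move/sub; rewrite cp' cp0; lia.
  have [p' pp' [np' cp']] := far _ Tp cp; have [q' qq' [nq' cq']] := far _ Tq cq.
  exists p', q'; split=> //.
  move: (dist_four p' c p q) (dist_four p' q c q') (dist_tri p' c q') (adj_dist1 pp') (adj_dist1 qq').
  move: (distC p' c) (distC p p') (distC q q') (distC c q') (distC q c); lia.
Qed.

Lemma sink_ball_down (n_ge3 : (2 < n)%N) i (m : nat) c r : sink_ball (orient o i) (D i) c r ->
  sink_ball (orient o (i - m%:Z)) (D (i - m%:Z)) c (r + m).
Proof.
elim: m => [|m IH] sb; first by rewrite subr0 addn0.
rewrite addnS; apply: sink_ball_prev => //.
by rewrite (_ : _ + 1 = i - m%:Z); [apply: IH|lia].
Qed.

(** A sink in the new support is adjacent to a source in the old one; sources have the wrong parity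
    for distance r, hence lie within r - 1. *)
Lemma sink_ball_next i c r x : sink_ball (orient o i) (D i) c r ->
  D (i + 1) x != 0%N -> (dist c x <= r)%N.
Proof.
have [red eqD eqS] := orbD; case=> r0 par sub _ nx.
case: (boolP (sink (orient o i) x)) => sx; last by apply: sub; rewrite -eqD.
have [|y xy ny] := dim_orbit_nbr sx; first by move: nx; lia.
have sy : ~~ sink (orient o i) y by rewrite (sink_adj _ xy) sx.
move: sy; rewrite (sink_dist _ par); have := sub _ ny; have := adj_dist c xy; lia.
Qed.

(** If the support left the sphere of radius r, neighbours of [p] and [q] would be antipodal at
    radius r - 1 and sinks of the next orientation, giving a sink ball around [c] again. *)
Lemma sink_ball_boundary i c r : sink_ball (orient o i) (D i) c r ->
  (forall c' r', ~ sink_ball (orient o (i + 1)) (D (i + 1)) c' r') ->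
  exists2 x, D (i + 1) x != 0%N & dist c x = r.
Proof.
move=> sb nsb; have [red eqD eqS] := orbD; apply: NNPP => nex.
have sub x : D (i + 1) x != 0%N -> (dist c x <= r.-1)%N.
  move=> nx; have := sink_ball_next sb nx.
  by case: (eqVneq (dist c x) r) => [e|]; [case: nex; exists x|lia].
have [r0 par sub0 [p] [q] [Tp Tq cp cq pq]] := sb.
have inner p0 : D i p0 != 0%N -> dist c p0 = r ->
    exists2 p', adj p0 p' & D (i + 1) p' != 0%N /\ dist c p' = r.-1.
  move=> np cp0; have sp : sink (orient o i) p0 by rewrite (sink_dist _ par) cp0 eqxx.
  have [|y py ny] := dim_orbit_nbr sp; first by move: np; lia.
  have sy : ~~ sink (orient o i) y by rewrite (sink_adj _ py) sp.
  exists y; rewrite ?eqD //; split=> //; have := sub0 _ ny; have := adj_dist c py; lia.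
have [p' pp' [np' cp']] := inner _ Tp cp; have [q' qq' [nq' cq']] := inner _ Tq cq.
have pq' : dist p' q' = (2 * r.-1)%N.
  move: (dist_tri p p' q') (dist_tri p q' q) (dist_tri p' c q') (adj_dist1 pp') (adj_dist1 qq').
  move: (distC p' c) (distC p p') (distC q q') (distC c q') (distC q c); lia.
have par' : odd (size c) (+) odd r.-1 = orient o (i + 1).
  by rewrite orientS -par; case: (r) r0 => //= m _; case: (odd _); case: (odd _).
(* A sink ball has positive radius, so r = 1 is separate: the support would be [c] alone, but a sink
   of nonzero dimension has a neighbour in the support. *)
case: (posnP r.-1) => [r1|r1]; last first.
  by apply: (nsb c r.-1); split=> //; exists p', q'.
have cE x : D (i + 1) x != 0%N -> x = c.
  by move/sub; rewrite r1 leqn0 => /eqP /dist_eq0.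
have [] := @dim_orbit_nbr (i + 1) p'.
- by rewrite (sink_dist _ par') cp' eqxx.
- by move: np'; lia.
by move=> y py /cE yc; have := adj_dist1 py; rewrite yc (cE _ np') distxx.
Qed.

(** At [i + 1] the vertex [x] is a source, and a farther neighbour is a sink outside the ball; its
    dimension is zero there and becomes nonzero by the reflection formula. *)
Lemma sink_ball_grow (n_ge3 : (2 < n)%N) i c r x : sink_ball (orient o i) (D i) c r ->
  D (i + 1) x != 0%N -> dist c x = r ->
  exists2 y, D (i + 1 + 1) y != 0%N & dist c y = r.+1.
Proof.
move=> sb nx cx; have [red eqD eqS] := orbD.
have [y xy cy] := farther_nbr n_ge3 c (red _ _ nx).
exists y; last by rewrite cy cx.
have [r0 par _ _] := sb.
have sy : sink (orient o (i + 1)) y.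
  by rewrite orientS sinkN (sink_adj _ xy) negbK (sink_dist _ par) cx eqxx.
have yx : adj y x by rewrite adjC.
have := dim_orbit_pos sy yx nx.
case: (eqVneq (D (i + 1) y) 0%N) => [->|]; first by rewrite addn0.
by move/(sink_ball_next sb); rewrite cy cx; lia.
Qed.

End SinkBalls.

(** A sink ball of [D'] at [i + 2] gives one of radius r' + 2 at [i]. In the injective case this
    ball is so small that [D' (i + 2)] misses the vertex of [D (i + 2)] at distance r + 1 from [c].
    In the surjective case the two balls at [i] coincide, and the vertex of [D (i + 1)] on the
    sphere lies neither in [D' (i + 1)] nor in [D' (i + 3)]. *)
Lemma sink_ball_step n (n_ge3 : (2 < n)%N) o (D D' : int -> seq 'I_n -> nat)
    (i : int) (c c' : seq 'I_n) (r r' : nat) :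
  dim_orbit o D -> dim_orbit o D' ->
  (forall j x, D' (j + 1 + 1) x != 0%N ->
     D (j + 1 + 1) x != 0%N \/ D j x != 0%N) ->
  (forall j x, D j x != 0%N -> D' j x != 0%N \/ D' (j + 1 + 1) x != 0%N) ->
  ((forall x, D i x != 0%N -> D' i x != 0%N) /\
   (forall x, D (i + 1 + 1) x != 0%N -> D' (i + 1 + 1) x != 0%N)) \/
  (forall x, D' i x != 0%N -> D i x != 0%N) ->
  sink_ball (orient o i) (D i) c r ->
  (forall c1 r1, ~ sink_ball (orient o (i + 1)) (D (i + 1)) c1 r1) ->
  ~ sink_ball (orient o (i + 1 + 1)) (D' (i + 1 + 1)) c' r'.
Proof.
move=> orb orb' inc1 inc2 dich sb nsb sb'2.
have sb'1 := sink_ball_prev orb' n_ge3 sb'2; have sb'0 := sink_ball_prev orb' n_ge3 sb'1.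
have [x nx cx] := sink_ball_boundary orb sb nsb.
have [_ _ sub _] := sb; have [_ _ sub'0 _] := sb'0.
have [_ _ sub'1 _] := sb'1; have [_ _ sub'2 _] := sb'2.
case: dich => [[m0 m2]|e0].
  have [y ny cy] := sink_ball_grow orb n_ge3 sb nx cx.
  have sbm := sink_ball_down orb n_ge3 2 sb; have [_ _ subm _] := sbm.
  (* The inclusion is used from [i - 2], where the ball of [D] has radius r + 2. *)
  have h : (dist c' c + r'.+2 <= r + 2)%N.
    apply: (sink_ball_sub sb'0) => z; have := inc1 (i - 2%:Z) z.
    rewrite (_ : i - 2%:Z + 1 + 1 = i); last by lia.
    by move=> /[apply] -[/sub|/subm]; lia.
  by have := sub'2 _ (m2 _ ny); have := dist_tri c c' y; rewrite (distC c' c) cy in h *; lia.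
have h1 : (dist c' c + r'.+2 <= r)%N.
  by apply: (sink_ball_sub sb'0) => z /e0 /sub.
have h2 : (dist c c' + r <= r'.+2)%N.
  by apply: (sink_ball_sub sb) => z /inc2 [/sub'0|/sub'2]; lia.
have cc : c = c' by apply: dist_eq0; lia.
have := cx; rewrite cc; case: (inc2 _ _ nx) => [/sub'1|]; first by lia.
by move/(sink_ball_next orb' sb'2); lia.
Qed.

(** * Homomorphisms and half links *)

(** Assembles a homomorphism from components that exist vertex by vertex and whose types depend on
    the vertex. *)
Lemma dep_choice (A : Type) (B : A -> Type) (P : forall a, B a -> Prop) :
  (forall a, exists b, P a b) -> exists f : forall a, B a, forall a, P a (f a).
Proof.
move=> H; exists (fun a => proj1_sig (constructive_indefinite_description _ (H a))).
by move=> a; case: (constructive_indefinite_description _ _).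
Qed.

Lemma mx0l (R : Type) m n (A B : 'M[R]_(m, n)) : m = 0%N -> A = B.
Proof. by move=> m0; apply/matrixP => -[i hi]; exfalso; rewrite m0 in hi. Qed.

Lemma mx0r (R : Type) m n (A B : 'M[R]_(m, n)) : n = 0%N -> A = B.
Proof. by move=> n0; apply/matrixP => ? [i hi]; exfalso; rewrite n0 in hi. Qed.

Section Homs.
Variables (k : fieldType) (n : nat).
Implicit Types (M N X Y : rep k n) (o : bool) (a x y : seq 'I_n).

Definition hid M : mor M M := fun a => 1%:M.
Definition hcomp M N X (f : mor M N) (g : mor N X) : mor M X :=
  fun a => f a *m g a.

Lemma hid_hom o M : is_hom o (hid M).
Proof. by move=> x y _; rewrite mulmx1 mul1mx. Qed.

Lemma hcomp_hom o M N X (f : mor M N) (g : mor N X) :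
  is_hom o f -> is_hom o g -> is_hom o (hcomp f g).
Proof. by move=> hf hg x y axy; rewrite /hcomp mulmxA hf // -!mulmxA hg. Qed.

Lemma module_dim0 o M a : is_module o M -> ~~ reduced a -> rdim M a = 0%N.
Proof. by case=> H _ _; apply: contraNeq => /H. Qed.

Lemma module_map0 o M x y : is_module o M -> ~~ arrow o x y -> rmap M x y = 0.
Proof. by case=> _ _; apply. Qed.

Definition monic M N (f : mor M N) : Prop :=
  forall a d (w : 'M_(d, rdim M a)), w *m f a = 0 -> w = 0.
Definition epic M N (f : mor M N) : Prop :=
  forall a d (w : 'M_(rdim N a, d)), f a *m w = 0 -> w = 0.

Lemma split_mono_monic o M N (f : mor M N) : split_mono o f -> monic f.
Proof.
by case=> g [_ fg] a d w w0; rewrite -[w]mulmx1 -(fg a) mulmxA w0 mul0mx.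
Qed.

Lemma split_epi_epic o M N (f : mor M N) : split_epi o f -> epic f.
Proof.
by case=> g [_ gf] a d w w0; rewrite -[w]mul1mx -(gf a) -mulmxA w0 mulmx0.
Qed.

Lemma dim_neq0P (d : nat) : d != 0%N <-> (1%:M : 'M[k]_d) <> 0.
Proof.
split; last by apply: contra_notN => /eqP d0; apply: mx0l.
by case: d => // d _ /matrixP /(_ 0 0) /eqP; rewrite !mxE eqxx oner_eq0.
Qed.

Lemma monic_dim M N (f : mor M N) a :
  monic f -> rdim M a != 0%N -> rdim N a != 0%N.
Proof.
move=> mf /dim_neq0P n1; apply/eqP => n0; apply: n1; apply: (mf a).
exact: mx0r.
Qed.

Lemma epic_dim M N (f : mor M N) a :
  epic f -> rdim N a != 0%N -> rdim M a != 0%N.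
Proof.
move=> mf /dim_neq0P n1; apply/eqP => n0; apply: n1; apply: (mf a).
exact: mx0l.
Qed.

(* [f] factors through its image. *)
Lemma irreducible_monic_or_epic o M N (f : mor M N) :
  is_module o M -> is_module o N -> irreducible o f -> monic f \/ epic f.
Proof.
move=> mM mN [hf nsm nse fac].
pose X := @Rep k n (fun a => \rank (f a))
  (fun x y => row_base (f x) *m rmap N x y *m pinvmx (row_base (f y))).
pose g : mor M X := fun a => col_base (f a).
pose h : mor X N := fun a => row_base (f a).
have gh a : f a = g a *m h a by rewrite /g /h mulmx_base.
have im x y : arrow o x y ->
    row_base (f x) *m rmap N x y *m pinvmx (row_base (f y)) *m row_base (f y) =
    row_base (f x) *m rmap N x y.
  move=> axy; apply: mulmxKpV; rewrite eq_row_base.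
  have /eqmxMr -> := eq_row_base (f x).
  by rewrite -hf // submxMl.
have mX : is_module o X.
  have [red [s fs] map0] := mN; split.
  - move=> a; rewrite /= -lt0n => r0; apply: red; rewrite -lt0n.
    exact: leq_trans r0 (rank_leq_col _).
  - exists s => a; rewrite /= -lt0n => r0; apply: fs; rewrite -lt0n.
    exact: leq_trans r0 (rank_leq_col _).
  - by move=> x y nxy; rewrite /= map0 // mulmx0 mul0mx.
have hh : is_hom o h by move=> x y axy; rewrite /h /= im.
have hg : is_hom o g.
  move=> x y axy; apply: (row_free_inj (row_base_free (f y))); rewrite /g /=.
  by rewrite -(mulmxA (col_base (f x))) im // mulmxA mulmx_base -hf // -mulmxA mulmx_base.
case: (fac X g h mX hg hh gh) => [/split_mono_monic mg|/split_epi_epic eh].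
  left=> a d w; rewrite gh mulmxA => w0; apply: (mg a).
  by apply: (row_free_inj (row_base_free (f a))); rewrite mul0mx.
right=> a d w; rewrite gh -mulmxA => w0; apply: (eh a).
have /(congr1 (mulmx (pinvmx (col_base (f a))))) := w0.
by rewrite mulmxA mulmx0 (mulVpmx (col_base_full _)) mul1mx.
Qed.

(** Joint injectivity of the maps leaving a source, that is, no simple summand at a source. Dually,
    [sink_free] is joint surjectivity at sinks. *)
Definition source_free o X : Prop := forall a d (w : 'M_(d, rdim X a)),
  ~~ sink o a -> reduced a -> (forall y, adj a y -> w *m rmap X a y = 0) -> w = 0.
Definition sink_free o X : Prop := forall a d (w : 'M_(rdim X a, d)),
  sink o a -> reduced a -> (forall y, adj a y -> rmap X y a *m w = 0) -> w = 0.

Lemma hom_eq_sinks o M N (f g : mor M N) : is_module o M -> source_free o N ->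
  is_hom o f -> is_hom o g -> (forall a, sink o a -> f a = g a) ->
  forall a, f a = g a.
Proof.
move=> mM sf hf hg e a; case: (boolP (sink o a)) => [/e //|sa].
case: (boolP (reduced a)) => ra; last by apply: mx0l; exact: module_dim0 mM ra.
apply/eqP; rewrite -subr_eq0; apply/eqP; apply: (sf _ _ _ sa ra) => y ay.
have sy : sink o y by rewrite (sink_adj _ ay).
have aay : arrow o a y by rewrite /arrow ay.
by rewrite mulmxBl -hf // -hg // e // subrr.
Qed.

Lemma hom_eq_sources o M N (f g : mor M N) : is_module o M -> sink_free o M ->
  is_hom o f -> is_hom o g -> (forall a, ~~ sink o a -> f a = g a) ->
  forall a, f a = g a.
Proof.
move=> mM sf hf hg e a; case: (boolP (sink o a)) => [sa|/e //].
case: (boolP (reduced a)) => ra; last by apply: mx0l; exact: module_dim0 mM ra.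
apply/eqP; rewrite -subr_eq0; apply/eqP; apply: (sf _ _ _ sa ra) => y ay.
have sy : ~~ sink o y by rewrite (sink_adj _ ay) sa.
have aya : arrow o y a by rewrite /arrow adjC ay.
by rewrite mulmxBr hf // hg // e // subrr.
Qed.

(* [half_link o M N]: up to identifying M_y and N_y at the sources y of o, the
   sequence N_a -> (+)_(y ~ a) M_y -> M_a is exact in the middle at every sink a.
   Exactness is phrased as a weak kernel and a weak cokernel property. *)
Record half_link o M N : Type := HalfLink {
  lto : forall y, 'M[k]_(rdim M y, rdim N y);
  lof : forall y, 'M[k]_(rdim N y, rdim M y);
  ltoK : forall y, ~~ sink o y -> lto y *m lof y = 1%:M;
  lofK : forall y, ~~ sink o y -> lof y *m lto y = 1%:M;
  link_comp0 : forall a, sink o a -> reduced a ->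
    \sum_(y <- nbrs a) rmap N a y *m lof y *m rmap M y a = 0;
  link_ker : forall a, sink o a -> reduced a ->
    forall d (u : forall y, 'M[k]_(d, rdim M y)),
    \sum_(y <- nbrs a) u y *m rmap M y a = 0 ->
    exists w, forall y, adj a y -> u y = w *m rmap N a y *m lof y;
  link_coker : forall a, sink o a -> reduced a ->
    forall d (u : forall y, 'M[k]_(rdim M y, d)),
    \sum_(y <- nbrs a) rmap N a y *m lof y *m u y = 0 ->
    exists w, forall y, adj a y -> u y = rmap M y a *m w }.

Arguments link_comp0 {o M N} h [a] _ _.
Arguments link_ker {o M N} h [a] _ _ [d u] _.
Arguments link_coker {o M N} h [a] _ _ [d u] _.

Definition compat o M N M' N' (L : half_link o M N) (L' : half_link o M' N')
    (f : mor M M') (g : mor N N') : Prop :=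
  forall y, ~~ sink o y -> f y *m lto L' y = lto L y *m g y.

(** * Transport of homomorphisms along half links *)

Section Transfer.
Variables (o : bool) (M N M' N' : rep k n).
Variables (L : half_link o M N) (L' : half_link o M' N').

Lemma compatE f g : compat L L' f g ->
  forall y, ~~ sink o y -> g y = lof L y *m f y *m lto L' y.
Proof. by move=> c y sy; rewrite -mulmxA c // mulmxA lofK // mul1mx. Qed.

Lemma compatE' f g : compat L L' f g ->
  forall y, ~~ sink o y -> f y = lto L y *m g y *m lof L' y.
Proof. by move=> c y sy; rewrite -c // -mulmxA ltoK // mulmx1. Qed.

(** Functoriality of the shift: at sources of [o] conjugate by the identifications, at sinks use the
    map induced on weak kernels. In [hom_down] weak cokernels play this part. *)
Lemma hom_up (f : mor M M') : is_hom o f ->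
  exists2 g : mor N N', is_hom (~~ o) g & compat L L' f g.
Proof.
move=> hf.
have [|g gP] := @dep_choice _ (fun v => 'M[k]_(rdim N v, rdim N' v)) (fun v gv =>
  (~~ sink o v -> gv = lof L v *m f v *m lto L' v) /\
  (sink o v -> forall y, adj v y ->
     rmap N v y *m lof L y *m f y = gv *m rmap N' v y *m lof L' y)).
  move=> a; case: (boolP (sink o a)) => sa; last by eexists; split=> // _; reflexivity.
  case: (boolP (reduced a)) => ra; last first.
    by exists 0; split=> // _ y /adj_reduced [ra' _]; rewrite ra' in ra.
  have [|w wP] := link_ker L' sa ra (u := fun y => rmap N a y *m lof L y *m f y).
    rewrite -[RHS](mul0mx _ (f a)) -(link_comp0 L sa ra) mulmx_suml.
    rewrite !big_seq; apply: eq_bigr => y; rewrite mem_nbrs // => ay.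
    by rewrite -!mulmxA hf // /arrow adjC ay.
  by exists w; split.
have gE y : ~~ sink o y -> g y = lof L y *m f y *m lto L' y by case: (gP y).
exists g; last by move=> y sy; rewrite gE // !mulmxA ltoK // mul1mx.
move=> x y /andP [xy]; rewrite sinkN => sy.
have sx : sink o x by rewrite -[sink o x]negbK -(sink_adj _ xy).
have [_ /(_ sx _ xy) E] := gP x.
by rewrite gE // mulmxA mulmxA E -mulmxA lofK // mulmx1.
Qed.

Lemma hom_down (g : mor N N') : is_hom (~~ o) g ->
  exists2 f : mor M M', is_hom o f & compat L L' f g.
Proof.
move=> hg.
have [|f fP] := @dep_choice _ (fun v => 'M[k]_(rdim M v, rdim M' v)) (fun v fv =>
  (~~ sink o v -> fv = lto L v *m g v *m lof L' v) /\
  (sink o v -> forall y, adj v y ->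
     lto L y *m g y *m lof L' y *m rmap M' y v = rmap M y v *m fv)).
  move=> a; case: (boolP (sink o a)) => sa; last by eexists; split=> // _; reflexivity.
  case: (boolP (reduced a)) => ra; last first.
    by exists 0; split=> // _ y /adj_reduced [ra' _]; rewrite ra' in ra.
  have [|w wP] := link_coker L sa ra
      (u := fun y => lto L y *m g y *m lof L' y *m rmap M' y a).
    rewrite -[RHS](mulmx0 _ (g a)) -(link_comp0 L' sa ra) mulmx_sumr.
    rewrite !big_seq; apply: eq_bigr => y; rewrite mem_nbrs // => ay.
    have sy : ~~ sink o y by rewrite (sink_adj _ ay) sa.
    rewrite !mulmxA -(mulmxA _ (lof L y)) lofK // mulmx1 hg //.
    by rewrite /arrow ay sinkN sy.
  by exists w; split.
have fE y : ~~ sink o y -> f y = lto L y *m g y *m lof L' y by case: (fP y).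
exists f; last by move=> y sy; rewrite fE // -!mulmxA lofK // mulmx1.
move=> x y /andP [xy sy].
have sx : ~~ sink o x by rewrite -(sink_adj _ xy).
have [_ /(_ sy x) <-] := fP y; rewrite ?fE //.
by rewrite adjC.
Qed.

Lemma compat_eq_up f g f' g' : is_module (~~ o) N -> source_free (~~ o) N' ->
  is_hom (~~ o) g -> is_hom (~~ o) g' -> compat L L' f g -> compat L L' f' g' ->
  (forall y, f y = f' y) -> forall y, g y = g' y.
Proof.
move=> mN sf hg hg' c c' e; apply: hom_eq_sinks mN sf hg hg' _ => a.
by rewrite sinkN => sa; rewrite (compatE c) // (compatE c') // e.
Qed.

Lemma compat_eq_down f g f' g' : is_module o M -> sink_free o M ->
  is_hom o f -> is_hom o f' -> compat L L' f g -> compat L L' f' g' ->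
  (forall y, g y = g' y) -> forall y, f y = f' y.
Proof.
move=> mN sf hg hg' c c' e; apply: hom_eq_sources mN sf hg hg' _ => a sa.
by rewrite (compatE' c) // (compatE' c') // e.
Qed.

(** Left exactness: whatever [g] kills at a sink of [o] is sent by the arrows into kernels at
    sources of [o], which vanish; [source_free] concludes. *)
Lemma monic_up f g : is_module (~~ o) N -> source_free (~~ o) N ->
  is_hom (~~ o) g -> compat L L' f g -> monic f -> monic g.
Proof.
move=> mN sf hg c mf.
have src y d (w : 'M_(d, rdim N y)) : ~~ sink o y -> w *m g y = 0 -> w = 0.
  move=> sy; rewrite (compatE c) // => w0.
  have /mf E : (w *m lof L y) *m f y = 0.
    by rewrite -[LHS]mulmx1 -(ltoK L' sy) -!mulmxA (mulmxA (f y)) (mulmxA (lof L y)) (mulmxA (lof L y)) mulmxA w0 mul0mx.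
  by rewrite -[w]mulmx1 -(lofK L sy) mulmxA E mul0mx.
move=> a d w w0; case: (boolP (sink o a)) => sa; last exact: src w0.
case: (boolP (reduced a)) => ra; last by apply: mx0r; exact: module_dim0 mN ra.
apply: (sf a) => //; first by rewrite sinkN sa.
move=> y ay; have sy : ~~ sink o y by rewrite (sink_adj _ ay) sa.
apply: src => //; rewrite -mulmxA hg ?mulmxA ?w0 ?mul0mx //.
by rewrite /arrow ay sinkN.
Qed.

End Transfer.

Lemma compat_comp o M N M' N' M'' N'' (L : half_link o M N) (L' : half_link o M' N')
    (L'' : half_link o M'' N'') f g f' g' :
  compat L L' f g -> compat L' L'' f' g' -> compat L L'' (hcomp f f') (hcomp g g').
Proof. by move=> c c' y sy; rewrite /hcomp -mulmxA c' // mulmxA c // mulmxA. Qed.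

Lemma compat_id o M N (L : half_link o M N) : compat L L (hid M) (hid N).
Proof. by move=> y _; rewrite mul1mx mulmx1. Qed.

(** Between strict links the correspondence of homomorphisms is bijective, so idempotents can be
    carried in both directions. *)
Definition link_strict o M N : Prop :=
  [/\ is_module o M, is_module (~~ o) N, sink_free o M & source_free (~~ o) N].

Lemma split_mono_down o M N M' N' (L : half_link o M N) (L' : half_link o M' N')
    (f : mor M M') (g : mor N N') : is_module o M -> sink_free o M -> is_hom o f ->
  compat L L' f g -> split_mono (~~ o) g -> split_mono o f.
Proof.
move=> mM sf hf c [r [hr gr]]; have [s hs cs] := hom_down L' L hr.
exists s; split=> //; apply: (compat_eq_down mM sf _ _ (compat_comp c cs) (compat_id L) gr).
- exact: hcomp_hom.
- exact: hid_hom.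
Qed.

Lemma split_epi_down o M N M' N' (L : half_link o M N) (L' : half_link o M' N')
    (f : mor M M') (g : mor N N') : is_module o M' -> sink_free o M' -> is_hom o f ->
  compat L L' f g -> split_epi (~~ o) g -> split_epi o f.
Proof.
move=> mM sf hf c [r [hr gr]]; have [s hs cs] := hom_down L' L hr.
exists s; split=> //; apply: (compat_eq_down mM sf _ _ (compat_comp cs c) (compat_id L') gr).
- exact: hcomp_hom.
- exact: hid_hom.
Qed.

Lemma split_mono_up o M N M' N' (L : half_link o M N) (L' : half_link o M' N')
    (f : mor M M') (g : mor N N') : is_module (~~ o) N -> source_free (~~ o) N ->
  is_hom (~~ o) g -> compat L L' f g -> split_mono o f -> split_mono (~~ o) g.
Proof.
move=> mM sf hf c [r [hr gr]]; have [s hs cs] := hom_up L' L hr.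
exists s; split=> //; apply: (compat_eq_up mM sf _ _ (compat_comp c cs) (compat_id L) gr).
- exact: hcomp_hom.
- exact: hid_hom.
Qed.

Lemma split_epi_up o M N M' N' (L : half_link o M N) (L' : half_link o M' N')
    (f : mor M M') (g : mor N N') : is_module (~~ o) N' -> source_free (~~ o) N' ->
  is_hom (~~ o) g -> compat L L' f g -> split_epi o f -> split_epi (~~ o) g.
Proof.
move=> mM sf hf c [r [hr gr]]; have [s hs cs] := hom_up L' L hr.
exists s; split=> //; apply: (compat_eq_up mM sf _ _ (compat_comp cs c) (compat_id L') gr).
- exact: hcomp_hom.
- exact: hid_hom.
Qed.

Lemma indecomposable_up o M N (L : half_link o M N) : link_strict o M N ->
  nonzero N -> indecomposable o M -> indecomposable (~~ o) N.
Proof.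
move=> [mM mN sM sN] nz [_ ind]; split=> // e he ee.
have [f hf c] := hom_down L L he.
have c0 : compat L L (fun _ => 0) (fun _ => 0) by move=> y _; rewrite mul0mx mulmx0.
have h0 : is_hom (~~ o) ((fun _ => 0) : mor N N) by move=> x y _; rewrite mul0mx mulmx0.
case: (ind f hf) => [|f0|f1].
- by apply: (compat_eq_down mM sM (hcomp_hom hf hf) hf (compat_comp c c) c ee).
- by left; apply: (compat_eq_up mN sN he h0 c c0 f0).
- by right; apply: (compat_eq_up mN sN he (@hid_hom _ N) c (compat_id L) f1).
Qed.

Lemma indecomposable_down o M N (L : half_link o M N) : link_strict o M N ->
  nonzero M -> indecomposable (~~ o) N -> indecomposable o M.
Proof.
move=> [mM mN sM sN] nz [_ ind]; split=> // e he ee.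
have [f hf c] := hom_up L L he.
have c0 : compat L L (fun _ => 0) (fun _ => 0) by move=> y _; rewrite mul0mx mulmx0.
have h0 : is_hom o ((fun _ => 0) : mor M M) by move=> x y _; rewrite mul0mx mulmx0.
case: (ind f hf) => [|f0|f1].
- by apply: (compat_eq_up mN sN (hcomp_hom hf hf) hf (compat_comp c c) c ee).
- by left; apply: (compat_eq_down mM sM he h0 c c0 f0).
- by right; apply: (compat_eq_down mM sM he (@hid_hom _ M) c (compat_id L) f1).
Qed.

End Homs.

Arguments link_comp0 {k n o M N} h [a] _ _.
Arguments link_ker {k n o M N} h [a] _ _ [d u] _.
Arguments link_coker {k n o M N} h [a] _ _ [d u] _.

(** * The shift functors as half links *)

(** The rows of [1%:M - A *m pinvmx A] lie in the left kernel of [A], so this matrix annihilates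
    [U]. *)
Lemma kermx_factor (k : fieldType) m n p (A : 'M[k]_(m, n)) (U : 'M_(m, p)) :
  kermx A *m U = 0 -> exists w, U = A *m w.
Proof.
move=> kU; exists (pinvmx A *m U); apply/eqP; rewrite -subr_eq0 mulmxA.
have -> : U - A *m pinvmx A *m U = (1%:M - A *m pinvmx A) *m U.
  by rewrite mulmxBl mul1mx.
have /submxP [w ->] : (1%:M - A *m pinvmx A <= kermx A)%MS.
  by apply/sub_kermxP; rewrite mulmxBl mul1mx mulmxKpV ?subrr.
by rewrite -mulmxA kU mulmx0.
Qed.

(** After transposition [cokermx A] lies in the space of solutions, and a rank count shows that it
    spans this space. *)
Lemma cokermx_factor (k : fieldType) m n p (A : 'M[k]_(m, n)) (V : 'M_(n, p)) :
  A *m V = 0 -> exists w, V = cokermx A *m w.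
Proof.
move=> AV; have sub : ((cokermx A)^T <= kermx A^T)%MS.
  by apply/sub_kermxP; rewrite -trmx_mul mulmx_coker trmx0.
have eqr : \rank (cokermx A)^T = \rank (kermx A^T).
  by rewrite mxrank_ker !mxrank_tr mxrank_coker.
have := mxrank_leqif_sup sub => -[_]; rewrite eqr eqxx => /esym sub'.
have /submxP [w wE] : (V^T <= (cokermx A)^T)%MS.
  by apply: submx_trans sub'; apply/sub_kermxP; rewrite -trmx_mul AV trmx0.
by exists w^T; rewrite -[V]trmxK wE trmx_mul trmxK.
Qed.

Section ConformCast.
Variable k : fieldType.

(** At a vertex that is not reflected, old and new dimension are equal but not convertible;
    [conform_mx] of the identity is the cast between them. *)
Lemma conform_castK m m' : m = m' ->
  conform_mx (0 : 'M[k]_(m, m')) (1%:M : 'M_m) *m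
  conform_mx (0 : 'M_(m', m)) (1%:M : 'M_m) = 1%:M.
Proof. by move=> e; case: _ / e; rewrite !conform_mx_id mulmx1. Qed.

Lemma conform_castK' m m' : m = m' ->
  conform_mx (0 : 'M[k]_(m', m)) (1%:M : 'M_m) *m
  conform_mx (0 : 'M_(m, m')) (1%:M : 'M_m) = 1%:M.
Proof. by move=> e; case: _ / e; rewrite !conform_mx_id mulmx1. Qed.

Lemma mul_conform_castr m m' p p' (A : 'M[k]_(m, p)) : m = m' -> p = p' ->
  conform_mx (0 : 'M_(m', p')) A *m conform_mx (0 : 'M_(p', p)) (1%:M : 'M_p) =
  conform_mx (0 : 'M_(m', m)) (1%:M : 'M_m) *m A.
Proof.
by move=> e e'; case: _ / e; case: _ / e'; rewrite !conform_mx_id mulmx1 mul1mx.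
Qed.

Lemma mul_conform_castl m m' p p' (A : 'M[k]_(m, p)) : m = m' -> p = p' ->
  conform_mx (0 : 'M_(m, m')) (1%:M : 'M_m) *m conform_mx (0 : 'M_(m', p')) A =
  A *m conform_mx (0 : 'M_(p, p')) (1%:M : 'M_p).
Proof.
by move=> e e'; case: _ / e; case: _ / e'; rewrite !conform_mx_id mulmx1 mul1mx.
Qed.

End ConformCast.

Section Sigma.
Variables (k : fieldType) (n : nat).
Implicit Types (M N X Y : rep k n) (o : bool) (a x y : seq 'I_n).

Lemma nbrs_nth a y : reduced a -> adj a y ->
  exists j : 'I_(size (nbrs a)), y = nth a (nbrs a) j.
Proof.
move=> ra; rewrite -mem_nbrs // => ya; rewrite -index_mem in ya.
by exists (Ordinal ya); rewrite /= nth_index // -index_mem.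
Qed.

Lemma sum_nbrs (V : nmodType) a (F : seq 'I_n -> V) :
  \sum_(y <- nbrs a) F y = \sum_(j < size (nbrs a)) F (nth a (nbrs a) j).
Proof. by rewrite (big_nth a) big_mkord. Qed.

Lemma mul_proj_nb M a d (B : 'M_(d, _)) (j : 'I_(size (nbrs a))) :
  B *m proj_nb M a (nth a (nbrs a) j) = submxrow B j.
Proof.
rewrite -{1}[B]submxrowK /proj_nb mul_mxrow_mxcol (bigD1 j) //=.
rewrite index_uniq ?nbrs_uniq // eqxx conform_mx_id mulmx1 big1 ?addr0 // => i ij.
by rewrite val_eqE (negbTE ij) mulmx0.
Qed.

Lemma mul_inj_nb M a d (B : 'M_(_, d)) (j : 'I_(size (nbrs a))) :
  inj_nb M a (nth a (nbrs a) j) *m B = submxcol B j.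
Proof.
rewrite -{1}[B]submxcolK /inj_nb mul_mxrow_mxcol (bigD1 j) //=.
rewrite index_uniq ?nbrs_uniq // eqxx conform_mx_id mul1mx big1 ?addr0 // => i ij.
by rewrite val_eqE (negbTE ij) mul0mx.
Qed.

Lemma sum_proj_nb M a d (u : forall y, 'M_(rdim M y, d)) :
  \sum_(y <- nbrs a) proj_nb M a y *m u y = \mxcol_j u (nth a (nbrs a) j).
Proof.
rewrite sum_nbrs /proj_nb; rewrite (eq_bigr _ (fun j _ => mxcol_mul _ _)) -mxcol_sum; apply/eq_mxcolP => i; rewrite (bigD1 i) //=.
rewrite index_uniq ?nbrs_uniq // eqxx conform_mx_id mul1mx big1 ?addr0 // => j ji.
by rewrite index_uniq ?nbrs_uniq // val_eqE eq_sym (negbTE ji) mul0mx.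
Qed.

Lemma sum_inj_nb M a d (u : forall y, 'M_(d, rdim M y)) :
  \sum_(y <- nbrs a) u y *m inj_nb M a y = \mxrow_j u (nth a (nbrs a) j).
Proof.
rewrite sum_nbrs /inj_nb; rewrite (eq_bigr _ (fun j _ => mul_mxrow _ _)) -mxrow_sum; apply/eq_mxrowP => i; rewrite (bigD1 i) //=.
rewrite index_uniq ?nbrs_uniq // eqxx conform_mx_id mulmx1 big1 ?addr0 // => j ji.
by rewrite index_uniq ?nbrs_uniq // val_eqE eq_sym (negbTE ji) mulmx0.
Qed.

Section Kernel.
Variables (o : bool) (M : rep k n).
Hypothesis mM : is_module o M.

Lemma sigma_dim_source y : ~~ sink o y -> rdim M y = rdim (sigma o M) y.
Proof. by move=> sy; rewrite /= /sig_dim (negbTE sy). Qed.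

Lemma sigma_dim_sink a : sink o a -> reduced a ->
  \rank (kermx (in_map M a)) = rdim (sigma o M) a.
Proof. by move=> sa ra; rewrite /= /sig_dim sa ra. Qed.

Lemma sigma_module : is_module (~~ o) (sigma o M).
Proof.
have [red [s fs] map0] := mM; split.
- move=> a; rewrite /= /sig_dim; case: ifP => [/andP [_ ra _]|_] //; exact: red.
- exists (s ++ flatten [seq nbrs x | x <- s & reduced x]) => a; rewrite mem_cat.
  rewrite /= /sig_dim; case: ifP => [/andP [sa ra]|_ /fs ->] //.
  rewrite -lt0n => /leq_trans -/(_ _ (rank_leq_row _)) pos; apply/orP; right.
  have /hasP [y ya ny] : has (fun y => rdim M y != 0%N) (nbrs a).
    apply: contraTT pos => /hasPn H; rewrite -leqNgt leqn0.
    rewrite -(sum_nbrs (V := nat)) big_seq big1 // => y /H; rewrite negbK => /eqP //.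
  apply/flattenP; exists (nbrs y); last by rewrite mem_nbrs ?red // adjC -mem_nbrs.
  by apply/mapP; exists y; rewrite // mem_filter red // fs.
- by move=> x y nxy; rewrite /= /sig_map (negbTE nxy).
Qed.

Let cto y : 'M[k]_(rdim M y, rdim (sigma o M) y) :=
  conform_mx 0 (1%:M : 'M_(rdim M y)).
Let cof y : 'M[k]_(rdim (sigma o M) y, rdim M y) :=
  conform_mx 0 (1%:M : 'M_(rdim M y)).

Let sigma_mapE a : sink o a -> reduced a ->
  exists K : 'M_(rdim (sigma o M) a, _),
    [/\ (K :=: kermx (in_map M a))%MS, row_free K
      & forall y, adj a y -> rmap (sigma o M) a y *m cof y = K *m proj_nb M a y].
Proof.
move=> sa ra; have e := sigma_dim_sink sa ra.
pose R : 'M[k]_(rdim (sigma o M) a, \rank (kermx (in_map M a))) :=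
  conform_mx 0 (1%:M : 'M_(\rank (kermx (in_map M a)))).
have Rf : row_full R.
  by apply/row_fullP; eexists; apply: conform_castK e.
have KE : (R *m row_base (kermx (in_map M a)) :=: kermx (in_map M a))%MS.
  exact: eqmx_trans (eqmxMfull _ Rf) (eq_row_base _).
exists (R *m row_base (kermx (in_map M a))); split=> // [|y ay].
  by rewrite -row_leq_rank KE e.
have sy : ~~ sink o y by rewrite (sink_adj _ ay) sa.
rewrite /= /sig_map ifT; last by rewrite /arrow ay sinkN.
rewrite -mulmxA /cof; apply: mul_conform_castr e _; exact: sigma_dim_source.
Qed.

Lemma sigma_source_free : source_free (~~ o) (sigma o M).
Proof.
move=> a d w; rewrite sinkN negbK => sa ra w0.
have [K [_ Kf KE]] := sigma_mapE sa ra.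
apply: (row_free_inj Kf); rewrite mul0mx; apply/mxrowP => j.
rewrite submxrow0 -mul_proj_nb -mulmxA -KE; last by rewrite -mem_nbrs // mem_nth.
by rewrite mulmxA w0 ?mul0mx // -mem_nbrs // mem_nth.
Qed.

Lemma sigma_link : half_link o M (sigma o M).
Proof.
exists cto cof.
- by move=> y sy; apply: conform_castK; apply: sigma_dim_source.
- by move=> y sy; apply: conform_castK'; apply: sigma_dim_source.
- move=> a sa ra; have [K [Kk _ KE]] := sigma_mapE sa ra; rewrite big_seq.
  under eq_bigr => y ya do rewrite KE -?mem_nbrs // -mulmxA.
  rewrite -big_seq -mulmx_sumr sum_proj_nb -/(in_map M a).
  by apply/sub_kermxP; rewrite Kk.
- move=> a sa ra d u u0; have [K [Kk _ KE]] := sigma_mapE sa ra.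
  have : (\mxrow_j u (nth a (nbrs a) j) <= K)%MS.
    by rewrite Kk; apply/sub_kermxP; rewrite /in_map mul_mxrow_mxcol -[RHS]u0 sum_nbrs.
  case/submxP=> w wE; exists w => y ay; rewrite -mulmxA KE // mulmxA -wE.
  by have [j ->] := nbrs_nth ra ay; rewrite mul_proj_nb mxrowK.
- move=> a sa ra d u u0; have [K [Kk _ KE]] := sigma_mapE sa ra.
  have Ku : K *m \mxcol_j u (nth a (nbrs a) j) = 0.
    rewrite -sum_proj_nb mulmx_sumr -[RHS]u0.
    rewrite [LHS]big_seq [RHS]big_seq; apply: eq_bigr => y; rewrite mem_nbrs // => ay.
    by rewrite KE // !mulmxA.
  have [w wE] : exists w, \mxcol_j u (nth a (nbrs a) j) = in_map M a *m w.
    apply: kermx_factor; have /submxP [z ->] : (kermx (in_map M a) <= K)%MS by rewrite Kk.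
    by rewrite -mulmxA Ku mulmx0.
  exists w => y ay; have [j ->] := nbrs_nth ra ay.
  by rewrite -[LHS](mxcolK (fun j => u (nth a (nbrs a) j))) wE mxcol_mul mxcolK.
Qed.

Lemma in_map_full a : sink_free o M -> sink o a -> reduced a -> row_full (in_map M a).
Proof.
move=> sf sa ra; rewrite -cokermx_eq0; apply/eqP; apply: (sf a) => // y ay.
have [j ->] := nbrs_nth ra ay.
by rewrite -[rmap _ _ _](mxcolK (fun j => rmap M (nth a (nbrs a) j) a)) submxcol_mul mulmx_coker submxcol0.
Qed.

Lemma sigma_dim_sum a : sink_free o M -> sink o a -> reduced a ->
  (rdim (sigma o M) a + rdim M a = \sum_(y <- nbrs a) rdim M y)%N.
Proof.
move=> sf sa ra; rewrite -sigma_dim_sink // mxrank_ker.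
have /eqP {2}<- := in_map_full sf sa ra; rewrite subnK ?rank_leq_row //.
by rewrite (sum_nbrs (V := nat)).
Qed.

End Kernel.

Section Cokernel.
Variables (o : bool) (X : rep k n).
Hypothesis mX : is_module o X.

Lemma sigmam_dim_sink y : sink o y -> rdim X y = rdim (sigmam o X) y.
Proof. by move=> sy; rewrite /= /sigm_dim sy. Qed.

Lemma sigmam_dim_source a : ~~ sink o a -> reduced a ->
  \rank (cokermx (out_map X a)) = rdim (sigmam o X) a.
Proof. by move=> sa ra; rewrite /= /sigm_dim sa ra. Qed.

Lemma sigmam_module : is_module (~~ o) (sigmam o X).
Proof.
have [red [s fs] map0] := mX; split.
- move=> a; rewrite /= /sigm_dim; case: ifP => [/andP [_ ra _]|_] //; exact: red.
- exists (s ++ flatten [seq nbrs x | x <- s & reduced x]) => a; rewrite mem_cat.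
  rewrite /= /sigm_dim; case: ifP => [/andP [sa ra]|_ /fs ->] //.
  rewrite -lt0n => /leq_trans -/(_ _ (rank_leq_col _)) pos; apply/orP; right.
  have /hasP [y ya ny] : has (fun y => rdim X y != 0%N) (nbrs a).
    apply: contraTT pos => /hasPn H; rewrite -leqNgt leqn0.
    rewrite -(sum_nbrs (V := nat)) big_seq big1 // => y /H; rewrite negbK => /eqP //.
  apply/flattenP; exists (nbrs y); last by rewrite mem_nbrs ?red // adjC -mem_nbrs.
  by apply/mapP; exists y; rewrite // mem_filter red // fs.
- by move=> x y nxy; rewrite /= /sigm_map (negbTE nxy).
Qed.

Let cof y : 'M[k]_(rdim X y, rdim (sigmam o X) y) :=
  conform_mx 0 (1%:M : 'M_(rdim X y)).
Let cto y : 'M[k]_(rdim (sigmam o X) y, rdim X y) :=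
  conform_mx 0 (1%:M : 'M_(rdim X y)).

Let coftoK y : sink o y -> cof y *m cto y = 1%:M.
Proof. by move=> sy; apply: conform_castK; apply: sigmam_dim_sink. Qed.

Let ctofK y : sink o y -> cto y *m cof y = 1%:M.
Proof. by move=> sy; apply: conform_castK'; apply: sigmam_dim_sink. Qed.

Let sigmam_mapE a : ~~ sink o a -> reduced a ->
  exists C : 'M_(_, rdim (sigmam o X) a),
    [/\ out_map X a *m C = 0, exists z, cokermx (out_map X a) = C *m z, row_full C
      & forall y, adj a y -> cof y *m rmap (sigmam o X) y a = inj_nb X a y *m C].
Proof.
move=> sa ra; have e := sigmam_dim_source sa ra.
pose R : 'M[k]_(\rank (cokermx (out_map X a)), rdim (sigmam o X) a) :=
  conform_mx 0 (1%:M : 'M_(\rank (cokermx (out_map X a)))).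
pose R' : 'M[k]_(rdim (sigmam o X) a, \rank (cokermx (out_map X a))) :=
  conform_mx 0 (1%:M : 'M_(\rank (cokermx (out_map X a)))).
have RR' : R *m R' = 1%:M by exact: conform_castK e.
have R'R : R' *m R = 1%:M by exact: conform_castK' e.
exists (col_base (cokermx (out_map X a)) *m R); split=> [||| y ay].
- rewrite -[col_base _]mulmx1 -(mulmxVp (row_base_free (cokermx (out_map X a)))).
  by rewrite (mulmxA (col_base _)) mulmx_base -(mulmxA (cokermx _)) (mulmxA (out_map X a)) mulmx_coker mul0mx.
- exists (R' *m row_base (cokermx (out_map X a))).
  by rewrite -mulmxA (mulmxA R) RR' mul1mx mulmx_base.
- apply/row_fullP; exists (R' *m pinvmx (col_base (cokermx (out_map X a)))).
  by rewrite -mulmxA (mulmxA (pinvmx _)) (mulVpmx (col_base_full _)) mul1mx.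
- have sy : sink o y by rewrite (sink_adj _ ay).
  rewrite /= /sigm_map ifT; last by rewrite /arrow adjC ay sinkN.
  rewrite mulmxA /cof; apply: mul_conform_castl e; exact: sigmam_dim_sink.
Qed.

Lemma sigmam_sink_free : sink_free (~~ o) (sigmam o X).
Proof.
move=> a d w; rewrite sinkN => sa ra w0.
have [C [_ _ Cf CE]] := sigmam_mapE sa ra.
rewrite -[w]mul1mx -(mulVpmx Cf) -mulmxA; suff -> : C *m w = 0 by rewrite mulmx0.
apply/mxcolP => j; have ay : adj a (nth a (nbrs a) j) by rewrite -mem_nbrs // mem_nth.
by rewrite submxcol0 -mul_inj_nb mulmxA -CE // -mulmxA w0 // mulmx0.
Qed.

(** The cokernel module stands on the left: [X] relates to it as a shift relates to its argument, so
    both reflections share one theory. *)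
Lemma sigmam_link : half_link (~~ o) (sigmam o X) X.
Proof.
exists cto cof.
- by move=> y; rewrite sinkN negbK; apply: ctofK.
- by move=> y; rewrite sinkN negbK; apply: coftoK.
- move=> a; rewrite sinkN => sa ra; have [C [C0 _ _ CE]] := sigmam_mapE sa ra.
  rewrite big_seq; under eq_bigr => y ya do rewrite -mulmxA CE -?mem_nbrs // mulmxA.
  by rewrite -big_seq -mulmx_suml sum_inj_nb.
- move=> a; rewrite sinkN => sa ra d u u0.
  have [C [_ [z zE] _ CE]] := sigmam_mapE sa ra.
  have uE y : adj a y -> u y = u y *m cto y *m cof y.
    by move=> ay; rewrite -mulmxA ctofK ?mulmx1 // (sink_adj _ ay).
  have UC : \mxrow_j (u (nth a (nbrs a) j) *m cto (nth a (nbrs a) j)) *m C = 0.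
    rewrite -(@sum_inj_nb X a _ (fun y => u y *m cto y)) mulmx_suml -[RHS]u0 [LHS]big_seq [RHS]big_seq.
    apply: eq_bigr => y; rewrite mem_nbrs // => ay.
    by rewrite [in RHS](uE _ ay) -!mulmxA -CE.
  have : (\mxrow_j (u (nth a (nbrs a) j) *m cto (nth a (nbrs a) j)) <= out_map X a)%MS.
    by rewrite submxE zE mulmxA UC mul0mx.
  case/submxP=> w wE; exists w => y ay; rewrite (uE _ ay).
  congr (_ *m _); have [j ->] := nbrs_nth ra ay.
  by rewrite -[LHS](mxrowK (fun j => u (nth a (nbrs a) j) *m cto (nth a (nbrs a) j))) wE mul_mxrow mxrowK.
- move=> a; rewrite sinkN => sa ra d u u0.
  have [C [_ [z zE] _ CE]] := sigmam_mapE sa ra.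
  have [|w wE] := @cokermx_factor _ _ _ _ (out_map X a) (\mxcol_j (cof (nth a (nbrs a) j) *m u (nth a (nbrs a) j))).
    rewrite /out_map mul_mxrow_mxcol -[RHS]u0 sum_nbrs.
    by apply: eq_bigr => j _; rewrite mulmxA.
  exists (z *m w) => y ay; have sy : sink o y by rewrite (sink_adj _ ay).
  rewrite -[u y]mul1mx -(ctofK sy) -[rmap _ _ _]mul1mx -(ctofK sy) -!mulmxA; congr (_ *m _).
  rewrite (mulmxA (cof y)) CE // -!mulmxA (mulmxA C) -zE -wE.
  by have [j ->] := nbrs_nth ra ay; rewrite mul_inj_nb mxcolK.
Qed.

Lemma out_map_free a : source_free o X -> ~~ sink o a -> reduced a -> row_free (out_map X a).
Proof.
move=> sf sa ra; rewrite -kermx_eq0; apply/eqP; apply: (sf a) => // y ay.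
have [j ->] := nbrs_nth ra ay.
by rewrite -[rmap _ _ _](mxrowK (fun j => rmap X a (nth a (nbrs a) j))) mul_submxrow mulmx_ker submxrow0.
Qed.

Lemma sigmam_dim_sum a : source_free o X -> ~~ sink o a -> reduced a ->
  (rdim X a + rdim (sigmam o X) a = \sum_(y <- nbrs a) rdim X y)%N.
Proof.
move=> sf sa ra; rewrite -sigmam_dim_source // mxrank_coker.
have /eqP {1}<- := out_map_free sf sa ra; rewrite subnKC ?rank_leq_col //.
by rewrite (sum_nbrs (V := nat)).
Qed.

End Cokernel.
End Sigma.

(** * Shift orbits *)

Lemma orientD o (i j : int) : orient o (i + j) = orient (orient o i) j.
Proof.
have E p (l : int) : orient p l = p (+) odd `|l|%N by case: p.
by rewrite !E -addbA; congr (_ (+) _); lia.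
Qed.

Lemma orient_iter o (m : nat) : iter m negb o = orient o m.
Proof.
by elim: m => [|m IH]; rewrite ?[orient _ _]/(xorb _ _) /= ?IH /orient; case: (o) => //=; case: (odd m).
Qed.

Lemma orient_iterN o (m : nat) : iter m negb o = orient o (- m%:Z).
Proof.
rewrite orient_iter; have E p (l : int) : orient p l = p (+) odd `|l|%N by case: p.
by rewrite !E; congr (_ (+) _); lia.
Qed.

Section Orbits.
Variables (k : fieldType) (n : nat).
Implicit Types (M N X Y : rep k n) (o : bool) (a x y : seq 'I_n).

(** A factorization of [g] through [X] moves to one of [f] through the inverse shift of [X]. The
    middle module is arbitrary, as the uniqueness arguments concern the two ends. *)
Lemma irreducible_up o M N M' N' (L : half_link o M N) (L' : half_link o M' N')
    (f : mor M M') (g : mor N N') :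
  link_strict o M N -> link_strict o M' N' ->
  is_hom (~~ o) g -> compat L L' f g -> irreducible o f -> irreducible (~~ o) g.
Proof.
move=> [mM mN kM cN] [mM' mN' kM' cN'] hg c [hf nsm nse fac]; split=> //.
- by move/(split_mono_down mM kM hf c).
- by move/(split_epi_down mM' kM' hf c).
move=> X g1 g2 mX hg1 hg2 gE.
have := sigmam_link (~~ o) X; have := sigmam_module mX; rewrite negbK => mY LY.
have [f1 hf1 c1] := hom_down L LY hg1; have [f2 hf2 c2] := hom_down LY L' hg2.
case: (fac _ f1 f2 mY hf1 hf2) => [|sm|se].
- exact: (compat_eq_down mM kM hf (hcomp_hom hf1 hf2) c (compat_comp c1 c2) gE).
- by left; apply: (split_mono_up mN cN hg1 c1 sm).
- by right; apply: (split_epi_up mN' cN' hg2 c2 se).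
Qed.

Lemma irreducible_down o M N M' N' (L : half_link o M N) (L' : half_link o M' N')
    (f : mor M M') (g : mor N N') :
  link_strict o M N -> link_strict o M' N' ->
  is_hom o f -> compat L L' f g -> irreducible (~~ o) g -> irreducible o f.
Proof.
move=> [mM mN kM cN] [mM' mN' kM' cN'] hf c [hg nsm nse fac]; split=> //.
- by move/(split_mono_up mN cN hg c).
- by move/(split_epi_up mN' cN' hg c).
move=> X f1 f2 mX hf1 hf2 fE.
have LY := sigma_link o X; have mY := sigma_module mX.
have [g1 hg1 c1] := hom_up L LY hf1; have [g2 hg2 c2] := hom_up LY L' hf2.
case: (fac _ g1 g2 mY hg1 hg2) => [|sm|se].
- exact: (compat_eq_up mN cN' hg (hcomp_hom hg1 hg2) c (compat_comp c1 c2) fE).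
- by left; apply: (split_mono_down mM kM hf1 c1 sm).
- by right; apply: (split_epi_down mM' kM' hf2 c2 se).
Qed.

Lemma inv_dim_le m p (A : 'M[k]_(m, p)) (B : 'M_(p, m)) :
  A *m B = 1%:M -> (m <= p)%N.
Proof. by move=> AB; rewrite -(mxrank1 k m) -AB (leq_trans (mxrankM_maxl _ _)) ?rank_leq_col. Qed.

Lemma inv_dim m p (A : 'M[k]_(m, p)) (B : 'M_(p, m)) :
  A *m B = 1%:M -> B *m A = 1%:M -> m = p.
Proof. by move=> /inv_dim_le h /inv_dim_le h'; apply/eqP; rewrite eqn_leq h. Qed.

Lemma half_link_dim o M N (L : half_link o M N) y :
  ~~ sink o y -> rdim N y = rdim M y.
Proof. by move=> sy; apply: (inv_dim (lofK L sy) (ltoK L sy)). Qed.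

Lemma sink_free_nz o M b : sink_free o M -> is_module o M -> sink o b ->
  rdim M b != 0%N -> exists2 y, ~~ sink o y & rdim M y != 0%N.
Proof.
move=> sf [red _ _] sb nb; apply: NNPP => H; move/(dim_neq0P k): (nb); apply.
apply: (sf b) => // [|y bay]; first exact: red.
apply: mx0l; apply/eqP; apply: contraT => ny; case: H.
by exists y; rewrite // (sink_adj _ bay) sb.
Qed.

Lemma source_free_nz o M b : source_free o M -> is_module o M -> ~~ sink o b ->
  rdim M b != 0%N -> exists2 y, sink o y & rdim M y != 0%N.
Proof.
move=> sf [red _ _] sb nb; apply: NNPP => H; move/(dim_neq0P k): (nb); apply.
apply: (sf b) => // [|y bay]; first exact: red.
apply: mx0r; apply/eqP; apply: contraT => ny; case: H.
by exists y; rewrite // (sink_adj _ bay).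
Qed.

Definition at_vertex M a (e : 'M[k]_(rdim M a)) : mor M M :=
  fun x => if x == a then conform_mx 0 e else 0.

Lemma at_vertexE M a e : @at_vertex M a e a = e.
Proof. by rewrite /at_vertex eqxx conform_mx_id. Qed.

Lemma at_vertex_neq M a e x : x != a -> @at_vertex M a e x = 0.
Proof. by rewrite /at_vertex => /negbTE ->. Qed.

Lemma at_vertex_idem M a (e : 'M[k]_(rdim M a)) : e *m e = e ->
  forall x, at_vertex e x *m at_vertex e x = at_vertex e x.
Proof.
move=> ee x; case: (eqVneq x a) => [->|xa]; first by rewrite at_vertexE.
by rewrite at_vertex_neq // mulmx0.
Qed.

Lemma indecomposable_at_vertex o M a (e : 'M[k]_(rdim M a)) :
  indecomposable o M -> e <> 0 -> e *m e = e -> is_hom o (at_vertex e) ->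
  forall x, x != a -> rdim M x = 0%N.
Proof.
move=> [_ ind] e0 ee he; case: (ind _ he (at_vertex_idem ee)) => [E0|E1] x xa.
  by case: e0; rewrite -(E0 a) at_vertexE.
apply/eqP; apply: contraT => /(dim_neq0P k) []; by rewrite -E1 at_vertex_neq.
Qed.

(* Otherwise an idempotent endomorphism concentrated at [a] splits off a summand
   supported at [a]. *)
Lemma indecomposable_sink_free o M N (L : half_link o M N) :
  is_module o M -> is_module (~~ o) N -> source_free (~~ o) N ->
  indecomposable o M -> nonzero N -> sink_free o M.
Proof.
move=> mM mN sN ind [b nb] a d w sa ra w0; apply: NNPP => wn0.
have wE : w *m pinvmx w *m w = w by rewrite mulmxKpV.
have z : forall x, x != a -> rdim M x = 0%N.
  apply: (indecomposable_at_vertex (e := w *m pinvmx w) ind).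
  - by move=> e0; apply: wn0; rewrite -wE e0 mul0mx.
  - by rewrite mulmxA wE.
  - move=> x y /andP [xy sy]; have sx : ~~ sink o x by rewrite -(sink_adj _ xy).
    have xa : x != a by apply: contraNneq sx => ->.
    rewrite (at_vertex_neq _ xa) mul0mx; case: (eqVneq y a) => [ya|ya].
      by rewrite ya at_vertexE mulmxA w0 ?mul0mx // adjC -ya.
    by rewrite at_vertex_neq // mulmx0.
have src y : ~~ sink o y -> rdim N y = 0%N.
  by move=> sy; rewrite (half_link_dim L) // z //; apply: contraNneq sy => ->.
case: (boolP (sink o b)) => sb; last by rewrite src in nb.
have [|y] := source_free_nz sN mN _ nb; first by rewrite sinkN negbK.
by rewrite sinkN => /src ->.
Qed.

(** Dual argument: [pinvmx w *m w] projects onto the row space of [w], which every arrow kills, so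
    it is an idempotent endomorphism concentrated at [a]. *)
Lemma indecomposable_source_free o M N (L : half_link o M N) :
  is_module o M -> is_module (~~ o) N -> sink_free o M ->
  indecomposable (~~ o) N -> nonzero M -> source_free (~~ o) N.
Proof.
move=> mM mN sM ind [b nb] a d w; rewrite sinkN negbK => sa ra w0; apply: NNPP => wn0.
have wE : w *m pinvmx w *m w = w by rewrite mulmxKpV.
have z : forall x, x != a -> rdim N x = 0%N.
  apply: (indecomposable_at_vertex (e := pinvmx w *m w) ind).
  - by move=> e0; apply: wn0; rewrite -wE -mulmxA e0 mulmx0.
  - by rewrite -mulmxA (mulmxA w) wE.
  - move=> x y /andP [xy]; rewrite sinkN => sy.
    have ya : y != a by apply: contraNneq sy => ->.
    rewrite (at_vertex_neq _ ya) mulmx0; case: (eqVneq x a) => [xa|xa].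
      by rewrite xa at_vertexE -mulmxA w0 ?mulmx0 // -xa.
    by rewrite at_vertex_neq // mul0mx.
have src y : ~~ sink o y -> rdim M y = 0%N.
  by move=> sy; rewrite -(half_link_dim L) // z //; apply: contraNneq sy => ->.
case: (boolP (sink o b)) => sb; last by rewrite src in nb.
by have [y /src ->] := sink_free_nz sM mM sb nb.
Qed.

(** One step of an orbit, with no trace of which of the two functors produced it. *)
Record linked o M N : Type := Linked {
  linked_half :> half_link o M N;
  linked_strict : link_strict o M N;
  linked_indl : indecomposable o M;
  linked_indr : indecomposable (~~ o) N;
  linked_sum : forall a, reduced a -> sink o a ->
    (rdim N a + rdim M a = \sum_(y <- nbrs a) rdim M y)%N }.

Lemma linked_sigma o M : is_module o M -> indecomposable o M ->
  nonzero (sigma o M) -> linked o M (sigma o M).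
Proof.
move=> mM ind nz; have L := sigma_link o M; have mN := sigma_module mM.
have sN := @sigma_source_free _ _ o M.
have sM := indecomposable_sink_free L mM mN sN ind nz.
have st : link_strict o M (sigma o M) by [].
split=> //; first exact: (indecomposable_up L st nz ind).
by move=> a ra sa; apply: sigma_dim_sum.
Qed.

Lemma linked_sigmam o N : is_module (~~ o) N -> indecomposable (~~ o) N ->
  nonzero (sigmam (~~ o) N) -> linked o (sigmam (~~ o) N) N.
Proof.
move=> mN ind nz; have := sigmam_link (~~ o) N; have := sigmam_module mN.
have := @sigmam_sink_free _ _ (~~ o) N; rewrite negbK => sM mM L.
have sN := indecomposable_source_free L mM mN sM ind nz.
have st : link_strict o (sigmam (~~ o) N) N by [].
split=> //; first exact: (indecomposable_down L st nz ind).
move=> a ra sa; rewrite sigmam_dim_sum ?sinkN ?negbK //.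
rewrite big_seq [RHS]big_seq; apply: eq_bigr => y; rewrite mem_nbrs // => ay.
by apply: (half_link_dim L); rewrite (sink_adj _ ay) sa.
Qed.

Definition orbit o (A : int -> rep k n) : Type :=
  forall i, linked (orient o i) (A i) (A (i + 1)).

(** Above 0 each step is a kernel step; below 0 it is a cokernel step read backwards. *)
Lemma sig_pow_orbit o M : is_module o M -> indecomposable o M -> regular o M ->
  orbit o (fun i => sig_pow o i M).
Proof.
move=> mM ind reg.
have up m : is_module (orient o m%:Z) (sigN m o M) /\
    indecomposable (orient o m%:Z) (sigN m o M).
  elim: m => [|m [mA iA]]; first by rewrite /orient /=; case: (o) mM ind.
  have nz := reg (Posz m.+1); rewrite /= orient_iter in nz.
  have [_ [_ mN _ _] _ iN _] := linked_sigma mA iA nz.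
  by rewrite -addn1 PoszD orientS addn1 /= orient_iter.
have step m : orient o (- m%:Z) = ~~ orient o (- m.+1%:Z).
  by rewrite -orientS; congr orient; lia.
have down m : is_module (orient o (- m%:Z)) (sigmN m o M) /\
    indecomposable (orient o (- m%:Z)) (sigmN m o M).
  elim: m => [|m [mA iA]]; first by rewrite /orient /=; case: (o) mM ind.
  have nz := reg (Negz m); rewrite /= orient_iterN step in nz.
  rewrite step in mA iA.
  have [_ [mN _ _ _] iN _ _] := linked_sigmam mA iA nz.
  have -> : sigmN m.+1 o M = sigmam (orient o (- m%:Z)) (sigmN m o M).
    by rewrite -orient_iterN.
  by rewrite (step m).
case=> m.
  have [mA iA] := up m; rewrite (_ : Posz m + 1 = Posz m.+1); last by lia.
  have nz := reg (Posz m.+1); rewrite /= orient_iter in nz *.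
  exact: linked_sigma.
have [mA iA] := down m.
have -> : sig_pow o (Negz m + 1) M = sigmN m o M.
  case: (m) => [|j]; first by rewrite (_ : Negz 0 + 1 = 0).
  by rewrite (_ : Negz j.+1 + 1 = Negz j) //; lia.
have nz := reg (Negz m); rewrite /= orient_iterN step in nz *.
rewrite step in mA iA; exact: linked_sigmam.
Qed.

Lemma orbit_module o A i : orbit o A -> is_module (orient o i) (A i).
Proof. by move/(_ i) => -[_ []]. Qed.

Lemma orbit_indecomposable o A i : orbit o A -> indecomposable (orient o i) (A i).
Proof. by move/(_ i) => -[]. Qed.

Lemma orbit_dim o A : orbit o A -> dim_orbit o (fun i => rdim (A i)).
Proof.
move=> orb; split.
- by move=> i x nx; have [red _ _] := orbit_module i orb; apply: red.
- by move=> i x sx; apply: (half_link_dim (orb i)).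
- by move=> i x rx sx; apply: (linked_sum (orb i)).
Qed.

Lemma orbit_shift2 o A : orbit o A -> orbit o (fun i => A (i + 1 + 1)).
Proof.
by move=> orb i; have := orb (i + 1 + 1); rewrite !orientS negbK.
Qed.

Lemma orbit_irreducible o A B (f : mor (A 0) (B 0)) : orbit o A -> orbit o B ->
  irreducible o f -> forall i, exists g : mor (A i) (B i), irreducible (orient o i) g.
Proof.
move=> oA oB irr.
have up i : (exists g : mor (A i) (B i), irreducible (orient o i) g) ->
    exists g : mor (A (i + 1)) (B (i + 1)), irreducible (orient o (i + 1)) g.
  case=> g ig; have [hg _ _ _] := ig; have [h hh c] := hom_up (oA i) (oB i) hg.
  exists h; rewrite orientS.
  exact: (irreducible_up (linked_strict (oA i)) (linked_strict (oB i)) hh c ig).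
have down i : (exists g : mor (A (i + 1)) (B (i + 1)), irreducible (orient o (i + 1)) g) ->
    exists g : mor (A i) (B i), irreducible (orient o i) g.
  rewrite orientS => -[g ig]; have [hg _ _ _] := ig; have [h hh c] := hom_down (oA i) (oB i) hg.
  exists h.
  exact: (irreducible_down (linked_strict (oA i)) (linked_strict (oB i)) hh c ig).
have base : exists g : mor (A 0) (B 0), irreducible (orient o 0) g.
  by exists f; rewrite /orient /=; case: (o) irr.
case=> m; first by elim: m => // m /up; rewrite (_ : Posz m + 1 = Posz m.+1) //; lia.
elim: m => [|m IH]; apply: down; first exact: base.
by rewrite (_ : Negz m.+1 + 1 = Negz m) //; lia.
Qed.

Lemma iso_dim o M o' N a : iso o M o' N -> rdim M a = rdim N a.
Proof. by case=> _ [f [g [_ _ fg gf]]]; apply: inv_dim (fg a) (gf a). Qed.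

Lemma iso_up o M N M' N' (L : half_link o M N) (L' : half_link o M' N') :
  is_module (~~ o) N -> source_free (~~ o) N ->
  is_module (~~ o) N' -> source_free (~~ o) N' ->
  iso o M o M' -> iso (~~ o) N (~~ o) N'.
Proof.
move=> mN sN mN' sN' [_ [f [g [hf hg fg gf]]]].
have [f' hf' cf] := hom_up L L' hf; have [g' hg' cg] := hom_up L' L hg.
split=> //; exists f', g'; split=> //.
  exact: (compat_eq_up mN sN (hcomp_hom hf' hg') (@hid_hom _ _ _ N) (compat_comp cf cg) (compat_id L) fg).
exact: (compat_eq_up mN' sN' (hcomp_hom hg' hf') (@hid_hom _ _ _ N') (compat_comp cg cf) (compat_id L') gf).
Qed.

Lemma iso_down o M N M' N' (L : half_link o M N) (L' : half_link o M' N') :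
  is_module o M -> sink_free o M -> is_module o M' -> sink_free o M' ->
  iso (~~ o) N (~~ o) N' -> iso o M o M'.
Proof.
move=> mN sN mN' sN' [_ [f [g [hf hg fg gf]]]].
have [f' hf' cf] := hom_down L L' hf; have [g' hg' cg] := hom_down L' L hg.
split=> //; exists f', g'; split=> //.
  exact: (compat_eq_down mN sN (hcomp_hom hf' hg') (@hid_hom _ _ _ M) (compat_comp cf cg) (compat_id L) fg).
exact: (compat_eq_down mN' sN' (hcomp_hom hg' hf') (@hid_hom _ _ _ M') (compat_comp cg cf) (compat_id L') gf).
Qed.

(** Links carry isomorphisms, so induction on t from 0 compares the iterated functor with the orbit,
    and opposite signs of s and t need no case of their own. *)
Lemma sig_pow_orbit_iso o A s t : orbit o A ->
  let o' := orient o (s + t) in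
  is_module o' (sig_pow (orient o s) t (A s)) /\
  iso o' (sig_pow (orient o s) t (A s)) o' (A (s + t)).
Proof.
move=> orb /=.
have refl i : iso (orient o i) (A i) (orient o i) (A i).
  by split=> //; exists (hid _), (hid _); split=> [||a|a]; rewrite ?mulmx1 //; apply: hid_hom.
case: t => m; rewrite /sig_pow.
  elim: m => [|m [mB isoB]]; first by rewrite addr0; split=> //; apply: orbit_module.
  have -> : s + m.+1%:Z = s + m%:Z + 1 by lia.
  have Eo : iter m negb (orient o s) = orient o (s + m%:Z) by rewrite orient_iter orientD.
  have [L [mA mA' kA cA] _ _ _] := orb (s + m%:Z).
  rewrite /= Eo orientS; split; first exact: sigma_module.
  exact: (iso_up (sigma_link _ _) L (sigma_module mB) (@sigma_source_free _ _ _ _) mA' cA isoB).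
suff H j : is_module (orient o (s - j%:Z)) (sigmN j (orient o s) (A s)) /\
    iso (orient o (s - j%:Z)) (sigmN j (orient o s) (A s)) (orient o (s - j%:Z)) (A (s - j%:Z)).
  by rewrite (_ : s + Negz m = s - m.+1%:Z); [apply: H|lia].
elim: j => [|j [mB isoB]]; first by rewrite subr0; split=> //; apply: orbit_module.
have Ej : s - j%:Z = s - j.+1%:Z + 1 by lia.
have Eo : iter j negb (orient o s) = ~~ orient o (s - j.+1%:Z).
  by rewrite orient_iterN -orientD Ej orientS.
have [L [mA mA' kA cA] _ _ _] := orb (s - j.+1%:Z).
move: mB isoB; rewrite {1 2 3}Ej orientS => mB isoB; rewrite -Ej in L mA' cA.
have mB' := sigmam_module mB; have LB := sigmam_link (~~ orient o (s - j.+1%:Z)) (sigmN j (orient o s) (A s)).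
have kB := @sigmam_sink_free _ _ (~~ orient o (s - j.+1%:Z)) (sigmN j (orient o s) (A s)).
rewrite negbK in LB mB' kB; rewrite /= Eo; split=> //.
exact: (iso_down LB L mB' kB mA kA isoB).
Qed.

End Orbits.

(** * Separation by trace forms *)

Section Separation.
Variable k : fieldType.

(** Enlarge a matrix with row space in [W] while a vector of [W] is missing; each time the rank
    grows. *)
Lemma subspace_mx N (W : 'rV[k]_N -> Prop) : W 0 ->
  (forall c u v, W u -> W v -> W (c *: u + v)) ->
  exists B : 'M[k]_N, forall v, W v <-> (v <= B)%MS.
Proof.
move=> W0 Wl.
suff H d (B : 'M[k]_N) : (forall v : 'rV_N, (v <= B)%MS -> W v) -> (N - \rank B < d)%N ->
    exists B' : 'M[k]_N, forall v, W v <-> (v <= B')%MS.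
  by apply: (H N.+1 0) => [v /submx0null -> //|]; rewrite ltnS leq_subr.
elim: d B => // d IH B BW rB.
case: (classic (exists2 v, W v & ~~ (v <= B)%MS)) => [[v Wv nvB]|nex]; last first.
  by exists B => v; split=> [Wv|/BW //]; apply: contraT => nvB; case: nex; exists v.
have lt : (\rank B < \rank (B + v)%MS)%N.
  by apply: rank_ltmx; rewrite ltmxE addsmxSl addsmx_sub submx_refl /= nvB.
apply: (IH (B + v)%MS); last by have := rank_leq_col (B + v)%MS; move: lt rB; lia.
move=> u /sub_addsmxP [[u1 u2] /= ->].
rewrite addrC (mx11_scalar u2) mul_scalar_mx; apply: Wl => //.
by apply: BW; rewrite submxMl.
Qed.

Lemma trace_mul_vec m p (A : 'M[k]_(m, p)) (w : 'rV_(m * p)) :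
  \tr (A *m (vec_mx w)^T) = (mxvec A *m w^T) 0 0.
Proof.
rewrite [RHS]mxE (reindex _ (curry_mxvec_bij _ _)) /=.
transitivity (\sum_i \sum_j A i j * w 0 (mxvec_index i j)).
  by apply: eq_bigr => i _; rewrite mxE; apply: eq_bigr => j _; rewrite !mxE.
by rewrite pair_bigA; apply: eq_bigr => -[i j] _ /=; rewrite mxvecE mxE.
Qed.

(** Flatten the coordinates in [L] to one row vector; some column of the cokernel matrix of the
    flattened [Z] does not kill [b] and is reshaped into [psi]. *)
Lemma trace_form_separation (I : eqType) (L : seq I) (p q : I -> nat)
    (Z : (forall i, 'M[k]_(p i, q i)) -> Prop) (b : forall i, 'M[k]_(p i, q i)) :
  uniq L -> Z (fun _ => 0) ->
  (forall c z z', Z z -> Z z' -> Z (fun i => c *: z i + z' i)) ->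
  (forall z z', (forall i, i \in L -> z i = z' i) -> Z z -> Z z') ->
  ~ Z b -> exists psi : forall i, 'M[k]_(q i, p i),
    (forall z, Z z -> \sum_(i <- L) \tr (z i *m psi i) = 0) /\
    \sum_(i <- L) \tr (b i *m psi i) != 0.
Proof.
(* [nth] needs a default in [I]; for empty [L] all families agree on [L], so [Z b] would hold. *)
case: L => [|i0 L' ] uL Z0 Zl Ze nZb.
  by case: nZb; apply: Ze Z0 => i; rewrite in_nil.
set L := i0 :: L' in uL Ze *.
pose s (j : 'I_(size L)) := nth i0 L j.
pose V (z : forall i, 'M[k]_(p i, q i)) := \mxrow_j mxvec (z (s j)).
have VE z z' : V z = V z' -> forall i, i \in L -> z i = z' i.
  rewrite /V => /eq_mxrowP e i iL; rewrite -index_mem in iL.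
  have := e (Ordinal iL); rewrite /s /= nth_index -?index_mem //.
  by move/(can_inj mxvecK).
have [|c u v|B BP] := @subspace_mx _ (fun v => exists2 z, Z z & v = V z).
- by exists (fun _ => 0) => //; rewrite /V; under eq_mxrow do rewrite linear0; rewrite mxrow0.
- case=> z Zz -> [z' Zz' ->]; exists (fun i => c *: z i + z' i); first exact: Zl.
  have E j : mxvec (c *: z (s j) + z' (s j)) = c *: mxvec (z (s j)) + mxvec (z' (s j)).
    by rewrite linearP.
  apply/mxrowP => j; rewrite submxrowD !mxrowK E; congr (_ + _).
  rewrite -[mxvec (z (s j))](mxrowK (fun j => mxvec (z (s j)))).
  by apply/matrixP => x y; rewrite !mxE.
have nb : ~~ (V b <= B)%MS.
  by apply/negP => /BP [z Zz e]; apply: nZb; apply: Ze Zz => i iL; apply/esym; apply: VE iL.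
have [t tP] : exists t, (V b *m cokermx B) 0 t != 0.
  move: nb; rewrite submxE => /eqP nb; apply/existsP; apply: contraT => /existsPn H.
  by case: nb; apply/rowP => t; have := H t; rewrite negbK => /eqP ->; rewrite mxE.
pose v : 'rV_(_) := (col t (cokermx B))^T.
pose psi i : 'M[k]_(q i, p i) :=
  if insub (index i L) is Some j then conform_mx 0 (vec_mx (submxrow v j : 'rV_(p (s j) * q (s j))))^T else 0.
have psiE j : psi (s j) = (vec_mx (submxrow v j))^T.
  by rewrite /psi index_uniq // valK conform_mx_id.
have pairE z : \sum_(i <- L) \tr (z i *m psi i) = (V z *m cokermx B) 0 t.
  have -> : (V z *m cokermx B) 0 t = (V z *m v^T) 0 0.
    rewrite trmxK [LHS]mxE [RHS]mxE; apply: eq_bigr => i _.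
    by congr (_ * _); rewrite [RHS]mxE.
  rewrite (big_nth i0) big_mkord -[v]submxrowK tr_mxrow mul_mxrow_mxcol summxE.
  by apply: eq_bigr => j _; rewrite -/(s j) psiE trace_mul_vec.
exists psi; split=> [z Zz|]; last by rewrite pairE.
have : (V z <= B)%MS by apply/BP; exists z.
by rewrite pairE submxE => /eqP ->; rewrite mxE.
Qed.

Lemma trace_nondegenerate m p (A : 'M[k]_(m, p)) :
  (forall H : 'M_(p, m), \tr (H *m A) = 0) -> A = 0.
Proof.
move=> tr0; apply/matrixP => i j; rewrite mxE -(tr0 (delta_mx j i)).
rewrite /mxtrace (bigD1 j) //= big1 ?addr0 => [|j' jj'].
  rewrite mxE (bigD1 i) //= big1 ?addr0 => [|i' ii']; first by rewrite mxE !eqxx mul1r.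
  by rewrite mxE (negbTE ii') andbF mul0r.
by rewrite mxE big1 // => i' _; rewrite mxE (negbTE jj') mul0r.
Qed.

End Separation.

Lemma big_uniq_support (V : nmodType) (I : eqType) (r s : seq I) (F : I -> V) :
  uniq r -> uniq s -> (forall i, i \notin r -> F i = 0) ->
  (forall i, i \notin s -> F i = 0) -> \sum_(i <- r) F i = \sum_(i <- s) F i.
Proof.
move=> ur us r0 s0.
have E (t u : seq I) : (forall i, i \notin u -> F i = 0) ->
    \sum_(i <- t) F i = \sum_(i <- t | i \in u) F i.
  move=> u0; rewrite [RHS]big_mkcond; apply: eq_bigr => i _.
  by case: ifPn => // /u0.
rewrite [LHS](E r s s0) [RHS](E s r r0) -[LHS]big_filter -[RHS]big_filter; apply: perm_big; apply: uniq_perm.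
- exact: filter_uniq.
- exact: filter_uniq.
- by move=> i; rewrite !mem_filter andbC.
Qed.

(** * Fitting's lemma and local endomorphism rings *)

Section Local.
Variables (k : fieldType) (n : nat).
Implicit Types (M N X Y : rep k n) (o : bool) (a x y : seq 'I_n).

Fixpoint hpow M (e : mor M M) (m : nat) : mor M M :=
  if m is m'.+1 then hcomp e (hpow e m') else hid M.

Lemma hpow_hom o M (e : mor M M) m : is_hom o e -> is_hom o (hpow e m).
Proof. by move=> he; elim: m => [|m IH]; [apply: hid_hom|apply: hcomp_hom]. Qed.

Lemma hpowD M (e : mor M M) i j a : hpow e (i + j) a = hpow e i a *m hpow e j a.
Proof. by elim: i => [|i IH] /=; rewrite ?mul1mx // /hcomp IH mulmxA. Qed.

Definition invertible M (e : mor M M) : Prop := forall a, e a \in unitmx.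

Lemma invertible_hom o M (e : mor M M) : is_hom o e -> invertible e ->
  is_hom o ((fun a => invmx (e a)) : mor M M).
Proof.
move=> he ie x y axy; apply: (can_inj (mulmxK (ie y))); apply: (can_inj (mulKmx (ie x))).
by rewrite mulmxKV // -!mulmxA he // mulKVmx // mulmxA mulmxK.
Qed.

Lemma nat_min (f : nat -> nat) : exists m, forall m', (f m <= f m')%N.
Proof.
suff H d m : (f m <= d)%N -> exists m, forall m', (f m <= f m')%N by apply: (H (f 0%N) 0%N).
elim: d m => [|d IH] m fm; first by exists m => m'; move: fm; lia.
case: (classic (forall m', (f m <= f m')%N)) => [|/not_all_ex_not [m' /negP mm']]; first by exists m.
by apply: (IH m'); move: mm' fm; lia.
Qed.

(** The exponent is the successor of one of minimal total rank: the rank stays minimal, and [e] is a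
    factor of the power. *)
Lemma hpow_rank_stable o M (e : mor M M) : is_module o M ->
  exists m, (0 < m)%N /\ forall a, \rank (hpow e (m + m) a) = \rank (hpow e m a).
Proof.
move=> [_ [s fs] _]; pose f m := (\sum_(a <- s) \rank (hpow e m a))%N.
have dec i j a : (\rank (hpow e (i + j) a) <= \rank (hpow e i a))%N.
  by rewrite hpowD mxrankM_maxl.
have [m mP] := nat_min f; exists m.+1; split=> // a; apply/eqP; rewrite eqn_leq dec /= leqNgt.
apply/negP => lt; have sa : a \in s.
  apply: fs; apply: contraTneq lt => d0; rewrite -leqNgt; apply: leq_trans (leq0n _).
  by rewrite -[X in (_ <= X)%N]d0 rank_leq_row.
have : (f (m.+1 + m.+1) < f m.+1)%N.
  rewrite /f !(big_rem a sa) /=; apply: (leq_ltn_trans (n := (\rank (hpow e (m.+1 + m.+1) a) + \sum_(b <- rem a s) \rank (hpow e m.+1 b))%N)).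
    by rewrite leq_add2l; apply: leq_sum => b _; apply: dec.
  by rewrite ltn_add2r.
have : (f m.+1 <= f m)%N by rewrite /f -addn1; apply: leq_sum => b _; apply: dec.
by have := mP (m.+1 + m.+1)%N; lia.
Qed.

(** For a power [P] of [e] whose square has the same rank, the projection [E] onto the image of [P]
    along its kernel is an endomorphism; being 0 or 1, it makes [P] zero or invertible. *)
Lemma fitting o M (e : mor M M) : is_module o M -> indecomposable o M ->
  is_hom o e -> (exists m, forall a, hpow e m a = 0) \/ invertible e.
Proof.
move=> mM [_ ind] he.
have [P [hP rk P0 P1]] : exists P : mor M M, [/\ is_hom o P,
    forall a, \rank (P a *m P a) = \rank (P a),
    (forall a, P a = 0) -> exists m, forall a, hpow e m a = 0
  & forall a W, P a *m W = 1%:M -> e a \in unitmx].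
  have [m0 [m0p rk]] := hpow_rank_stable e mM; case: m0 m0p rk => // m _ rk.
  exists (hpow e m.+1); split; [exact: hpow_hom| |by exists m.+1|] => a.
    by rewrite -hpowD rk.
  by move=> W /=; rewrite /hcomp -mulmxA => /mulmx1_unit [].
have [|E EP] := @dep_choice _ (fun a => 'M[k]_(rdim M a)) (fun a E =>
  [/\ E *m P a = P a, P a *m E = P a, exists Z, E = Z *m P a & exists W, E = P a *m W]).
  move=> a; have /submxP [Z ZE] : (P a <= P a *m P a)%MS.
    by have [_ <-] := mxrank_leqif_sup (submxMl (P a) (P a)); rewrite rk.
  have /submxP [W' WE] : ((P a)^T <= (P a)^T *m (P a)^T)%MS.
    have [_ <-] := mxrank_leqif_sup (submxMl (P a)^T (P a)^T).
    by rewrite -trmx_mul !mxrank_tr rk.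
  have {}WE : P a = P a *m P a *m W'^T by rewrite -[LHS]trmxK WE !trmx_mul !trmxK.
  have ZW : Z *m P a = P a *m W'^T by rewrite {1}WE (mulmxA Z) -ZE.
  exists (Z *m P a); split.
  - by rewrite -mulmxA -ZE.
  - by rewrite ZW mulmxA -WE.
  - by exists Z.
  - by exists W'^T.
(* Both sides equal [E x *m rmap M x y *m E y], because [E] factors through [P] on the left and on
   the right. *)
have hE : is_hom o E.
  move=> x y axy; have hPa := hP _ _ axy.
  have [_ _ [Z ZE] _] := EP x; have [_ PE _ [W WE]] := EP y.
  have [EPx _ _ _] := EP x.
  transitivity (E x *m rmap M x y *m E y).
    by rewrite WE !mulmxA hPa -(mulmxA (E x)) hPa mulmxA EPx.
  by rewrite {1}ZE -!mulmxA (mulmxA (P x)) -hPa -mulmxA PE hPa mulmxA -ZE.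
case: (ind E hE) => [a|E0|E1].
- by have [_ PE [Z ZE] _] := EP a; rewrite {1}ZE -mulmxA PE -ZE.
- by left; apply: P0 => a; have [<- _ _ _] := EP a; rewrite E0 mul0mx.
- by right=> a; have [_ _ _ [W WE]] := EP a; apply: (P1 a W); rewrite -WE E1.
Qed.

(** If [1 - e] were nilpotent, [e] would be invertible, since [1 - e] is the identity on the kernel
    of [e]. *)
Lemma invertible_sub1 o M (e : mor M M) : is_module o M -> indecomposable o M ->
  is_hom o e -> ~ invertible e -> invertible ((fun a => 1%:M - e a) : mor M M).
Proof.
move=> mM ind he nie; set e' := (X in invertible X).
have he' : is_hom o e'.
  by move=> x y axy; rewrite /e' mulmxBr mulmxBl he // mulmx1 mul1mx.
case: (fitting mM ind he') => // -[m em]; exfalso; apply: nie => a.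
rewrite -row_free_unit -kermx_eq0; set K := kermx _.
have Ke : K *m e' a = K by rewrite mulmxBr mulmx1 mulmx_ker subr0.
suff <- : K *m hpow e' m a = K by rewrite em mulmx0.
by elim: (m) => [|j IH] /=; rewrite ?mulmx1 // /hcomp mulmxA Ke.
Qed.

(** Makes the nonunits of End(M) a subspace, as the separation theorem requires. *)
Lemma not_invertible_add o M (e f : mor M M) : is_module o M -> indecomposable o M ->
  is_hom o e -> is_hom o f -> ~ invertible e -> ~ invertible f ->
  ~ invertible ((fun a => e a + f a) : mor M M).
Proof.
move=> mM ind he hf nie nif iv; set s := (X in invertible X) in iv.
have hs : is_hom o s.
  by move=> x y axy; rewrite /s mulmxDr mulmxDl he // hf.
have hg := invertible_hom hs iv; set g : mor M M := (X in is_hom o X) in hg.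
have sg a : e a *m g a + f a *m g a = 1%:M by rewrite -mulmxDl mulmxV.
apply: nif => a.
have nx : ~ invertible (hcomp e g).
  by move=> H; apply: nie => b; have := H b; rewrite unitmx_mul => /andP [].
have := invertible_sub1 mM ind (hcomp_hom he hg) nx a.
by rewrite /hcomp -(sg a) addrC addKr unitmx_mul => /andP [].
Qed.

End Local.

(** * Almost split extensions *)

Section AlmostSplit.
Variables (k : fieldType) (n : nat).
Implicit Types (M N X Y C A : rep k n) (o : bool) (a x y : seq 'I_n).

Definition cochain X Y := forall x y, 'M[k]_(rdim X x, rdim Y y).

(* Cochains modulo coboundaries describe Ext^1(X, Y). *)
Definition coboundary o X Y (t : cochain X Y) : Prop :=
  exists h : mor X Y, forall y a, arrow o y a ->
    t y a = h y *m rmap Y y a - rmap X y a *m h a.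

(** In the last clause the pullback of the extension along [p] splits, which means that [p] lifts to
    the middle term. *)
Definition right_almost_split o C A (t : cochain C A) : Prop :=
  [/\ forall y a, ~~ arrow o y a -> t y a = 0, ~ coboundary o t
    & forall X (p : mor X C), is_module o X -> is_hom o p -> ~ split_epi o p ->
        coboundary o ((fun y a => p y *m t y a) : cochain X A)].

Section Existence.
Variables (o : bool) (C A : rep k n).
(** In the application A is the double shift of C, and [pr] passes through the single shift. The
    hypotheses below state exactness of A_y -> (+) A_a -> C_y -> 0 at sources y, and of A_a -> (+)
    C_y -> C_a at sinks a in the middle. *)
Variable pr : forall a y, 'M[k]_(rdim A a, rdim C y).
Hypotheses (mC : is_module o C) (mA : is_module o A) (iC : indecomposable o C).
Hypothesis kC : sink_free o C.
Hypothesis pr_arrow : forall a y, ~~ arrow o y a -> pr a y = 0.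
Hypothesis pr_sink : forall a, sink o a -> reduced a ->
  \sum_(y <- nbrs a) pr a y *m rmap C y a = 0.
Hypothesis pr_source : forall y, ~~ sink o y -> reduced y ->
  \sum_(a <- nbrs y) rmap A y a *m pr a y = 0.
Hypothesis pr_source_factor : forall y, ~~ sink o y -> reduced y ->
  forall d (u : forall a, 'M_(rdim A a, d)),
  \sum_(a <- nbrs y) rmap A y a *m u a = 0 ->
  exists w, forall a, adj y a -> u a = pr a y *m w.
Hypothesis pr_source_inj : forall y, ~~ sink o y -> reduced y ->
  forall d (w : 'M_(rdim C y, d)),
  (forall a, adj y a -> pr a y *m w = 0) -> w = 0.
Hypothesis pr_sink_factor : forall a, sink o a -> reduced a ->
  forall d (u : forall y, 'M_(rdim C y, d)),
  \sum_(y <- nbrs a) pr a y *m u y = 0 ->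
  exists w, forall y, adj a y -> u y = rmap C y a *m w.

Lemma arrow_adj (y a : seq 'I_n) : arrow o y a -> adj y a.
Proof. by case/andP. Qed.

Let sum_nbrs_support (V : nmodType) (S : seq (seq 'I_n)) a (F : seq 'I_n -> V) :
  uniq S -> reduced a -> (forall y, y \notin S -> F y = 0) ->
  (forall y, ~~ adj a y -> F y = 0) -> \sum_(y <- S) F y = \sum_(y <- nbrs a) F y.
Proof.
move=> uS ra S0 a0; apply: big_uniq_support => //; first exact: nbrs_uniq.
by move=> y; rewrite mem_nbrs // => /a0.
Qed.

Let pr_sinkS S a : uniq S -> (forall x, rdim C x != 0%N -> x \in S) ->
  \sum_(y <- S) pr a y *m rmap C y a = 0.
Proof.
move=> uS CS; case: (boolP (reduced a && sink o a)) => [/andP [ra sa]|nra].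
  rewrite (sum_nbrs_support (a := a)) ?pr_sink // => y.
    by move=> /(contraNN (CS y)); rewrite negbK => /eqP y0; rewrite (@mx0r _ _ _ (pr a y) 0 y0) mul0mx.
  by move=> nay; rewrite pr_arrow ?mul0mx //; apply: contraNN nay => /arrow_adj; rewrite adjC.
rewrite big1 // => y _; rewrite pr_arrow ?mul0mx //.
by apply: contraNN nra => /andP [/adj_reduced [_ ->] ->].
Qed.

Let pr_sourceS S y : uniq S -> (forall x, rdim A x != 0%N -> x \in S) ->
  \sum_(a <- S) rmap A y a *m pr a y = 0.
Proof.
move=> uS CS; case: (boolP (reduced y && ~~ sink o y)) => [/andP [ra sa]|nra].
  rewrite (sum_nbrs_support (a := y)) ?pr_source // => a.
    by move=> /(contraNN (CS a)); rewrite negbK => /eqP y0; rewrite (@mx0l _ _ _ (pr a y) 0 y0) mulmx0.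
  by move=> nay; rewrite pr_arrow ?mulmx0 //; apply: contraNN nay => /arrow_adj.
rewrite big1 // => a _; rewrite pr_arrow ?mulmx0 //.
apply: contraNN nra => /andP [ya sa]; have [-> _] := adj_reduced ya.
by rewrite -(sink_adj _ ya).
Qed.

Let support_list : exists S : seq (seq 'I_n), [/\ uniq S,
  forall x, rdim C x != 0%N -> x \in S & forall x, rdim A x != 0%N -> x \in S].
Proof.
have [_ [s fs] _] := mC; have [_ [s' fs'] _] := mA; exists (undup (s ++ s')).
by split=> [|x /fs|x /fs']; rewrite ?undup_uniq // mem_undup mem_cat => ->; rewrite ?orbT.
Qed.

(* A form on the endomorphisms of C that kills the non-automorphisms but not 1. *)
Let dual_cochain S : uniq S -> (forall x, rdim C x != 0%N -> x \in S) ->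
  (forall x, rdim A x != 0%N -> x \in S) ->
  exists t : cochain C A, [/\ forall y a, ~~ arrow o y a -> t y a = 0,
    forall e : mor C C, is_hom o e -> ~ invertible e ->
      \sum_(y <- S) \sum_(a <- S) \tr (pr a y *m e y *m t y a) = 0
  & \sum_(y <- S) \sum_(a <- S) \tr (pr a y *m t y a) != 0].
Proof.
move=> uS CS AS; pose L := [seq (y, a) | y <- S, a <- S].
pose I : eqType := (seq 'I_n * seq 'I_n)%type.
have [||||| psi [psi0 psi1]] := @trace_form_separation k I L
    (fun i => rdim A i.2) (fun i => rdim C i.1)
    (fun z => exists e : mor C C, [/\ is_hom o e, ~ invertible e
       & forall i, i \in L -> z i = pr i.2 i.1 *m e i.1]) (fun i => pr i.2 i.1).
- by apply: allpairs_uniq => // -[y a] [y' a'] _ _ [-> ->].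
- exists (fun _ => 0); split=> [x y _|iv|i _]; rewrite ?mulmx0 ?mul0mx //.
  have [[b /(dim_neq0P k) nb] _] := iC; apply: nb.
  have /mulmxV := iv b; by rewrite mul0mx.
- move=> c z z' [e [he nie eE]] [e' [he' nie' eE']].
  exists (fun x => c *: e x + e' x); split.
  + by move=> x y axy; rewrite mulmxDr mulmxDl -scalemxAr -scalemxAl he // he'.
  + apply: (not_invertible_add (e := fun x => c *: e x) mC iC _ he' _ nie').
      by move=> x y axy; rewrite -scalemxAr -scalemxAl he.
    move=> iv; apply: nie => x; have /mulmxV := iv x.
    by rewrite -scalemxAl scalemxAr => /mulmx1_unit [].
  + by move=> i iL; rewrite mulmxDr -scalemxAr eE // eE'.
- move=> z z' zz' [e [he nie eE]]; exists e; split=> // i iL.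
  by rewrite -zz' // eE.
(* An endomorphism is determined by its composite with [pr], at sources by [pr_source_inj] and then
   at sinks because [C] is sink-free; so only 1 yields [pr] itself. *)
- case=> e [he nie eE]; apply: nie => x.
  suff -> : e x = hid C x by apply: unitmx1.
  apply: (hom_eq_sources mC kC he (@hid_hom _ _ _ C)) => y sy.
  case: (boolP (reduced y)) => ry; last by apply: mx0l; apply: module_dim0 mC ry.
  apply/eqP; rewrite -subr_eq0; apply/eqP; apply: (pr_source_inj sy ry) => a ya.
  rewrite mulmxBr /hid mulmx1; case: (boolP ((y, a) \in L)) => [/eE <-|]; first by rewrite subrr.
  move=> nL; have : (y \notin S) || (a \notin S).
    by rewrite -negb_and; apply: contraNN nL => /andP [yS aS]; apply: allpairs_f.
  case/orP => /contraNN; [move/(_ _ (CS y))|move/(_ _ (AS a))]; rewrite negbK => /eqP d0.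
    exact: mx0r.
  exact: mx0l.
pose t : cochain C A := fun y a => if arrow o y a then psi (y, a) else 0.
have tE e : \sum_(y <- S) \sum_(a <- S) \tr (pr a y *m e y *m t y a) =
    \sum_(i <- L) \tr (pr i.2 i.1 *m e i.1 *m psi i).
  rewrite big_allpairs_dep; apply: eq_bigr => y _; apply: eq_bigr => a _.
  by rewrite /t /=; case: ifPn => // /pr_arrow ->; rewrite !mul0mx.
exists t; split=> [y a nya|e he nie|]; first by rewrite /t (negbTE nya).
- by rewrite tE; apply: psi0; exists e; split.
- have := tE (hid C); rewrite /hid.
  under eq_bigr do under eq_bigr do rewrite mulmx1.
  by move=> ->; under eq_bigr do rewrite mulmx1.
Qed.

(** Pairing with [pr] kills coboundaries: after rotating the traces, the two halves contain the
    vanishing sums of [pr] at sinks and at sources. *)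
Let dual_cochain_not_coboundary S (t : cochain C A) :
  uniq S -> (forall x, rdim C x != 0%N -> x \in S) ->
  (forall x, rdim A x != 0%N -> x \in S) ->
  \sum_(y <- S) \sum_(a <- S) \tr (pr a y *m t y a) != 0 -> ~ coboundary o t.
Proof.
move=> uS CS AS /eqP nz [h hE]; apply: nz.
transitivity (\sum_(y <- S) \sum_(a <- S) (\tr (pr a y *m (h y *m rmap A y a)) -
    \tr (pr a y *m rmap C y a *m h a))).
  apply: eq_bigr => y _; apply: eq_bigr => a _; case: (boolP (arrow o y a)) => ya.
    by rewrite hE // mulmxBr mulmxA raddfB /= !mulmxA.
  by rewrite pr_arrow // !mul0mx raddf0 subrr.
under eq_bigr do rewrite big_split /= sumrN.
rewrite big_split /= sumrN [X in _ - X]exchange_big /= !big1 ?subrr // => [a|y] _.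
  by rewrite -raddf_sum -mulmx_suml pr_sinkS // mul0mx raddf0.
under eq_bigr => a _ do rewrite mxtrace_mulC -mulmxA.
by rewrite -raddf_sum -mulmx_sumr pr_sourceS // mulmx0 raddf0.
Qed.

(* The annihilator of the coboundaries is Hom(C, X). *)
Let annihilator_hom S X (psi : forall y a, 'M[k]_(rdim A a, rdim X y)) :
  is_module o X -> uniq S -> (forall x, rdim A x != 0%N -> x \in S) ->
  (forall x, rdim X x != 0%N -> x \in S) ->
  (forall h : mor X A, \sum_(y <- S) \sum_(a <- S)
     \tr ((h y *m rmap A y a - rmap X y a *m h a) *m psi y a) = 0) ->
  exists2 e : mor C X, is_hom o e & forall y a, arrow o y a -> psi y a = pr a y *m e y.
Proof.
move=> mX uS AS XS psi0.
pose U v := \sum_(a <- S) rmap A v a *m psi v a.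
pose V v := \sum_(y <- S) psi y v *m rmap X y v.
have sumE (h : mor X A) : \sum_(v <- S) \tr (h v *m (U v - V v)) = 0.
  rewrite -[RHS](psi0 h); symmetry.
  transitivity (\sum_(y <- S) \sum_(a <- S) (\tr (h y *m (rmap A y a *m psi y a)) -
      \tr (h a *m (psi y a *m rmap X y a)))).
    apply: eq_bigr => y _; apply: eq_bigr => a _.
    by rewrite mulmxBl raddfB /= -!mulmxA [X in _ - X]mxtrace_mulC -!mulmxA.
  under eq_bigr do rewrite big_split /= sumrN.
  rewrite big_split /= sumrN [X in _ - X]exchange_big /= -sumrB; apply: eq_bigr => v _.
  by rewrite -!raddf_sum -raddfB -mulmxBr.
(* By orientation [V] vanishes at sources and [U] at sinks, so this equality supplies the vanishing
   sums for both factorizations below. *)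
have UV v : U v = V v.
  case: (boolP (v \in S)) => vS; last first.
    by apply: mx0l; apply: contraNeq vS; apply: AS.
  apply/eqP; rewrite -subr_eq0; apply/eqP; apply: trace_nondegenerate => H.
  have := sumE (fun x => if x == v then conform_mx 0 H else 0).
  rewrite (bigD1_seq v) //= eqxx conform_mx_id big1 ?addr0 // => x xv.
  by rewrite (negbTE xv) mul0mx raddf0.
have V0 v : ~~ sink o v -> V v = 0.
  by move=> sv; rewrite /V big1 // => y _; rewrite (module_map0 mX) ?mulmx0 // /arrow (negbTE sv) andbF.
have U0 v : sink o v -> U v = 0.
  move=> sv; rewrite /U big1 // => a _; rewrite (module_map0 mA) ?mul0mx //.
  by apply/negP => /andP [va sa]; rewrite (sink_adj _ va) sv in sa.
have [|e eP] := @dep_choice _ (fun v => 'M[k]_(rdim C v, rdim X v)) (fun v ev =>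
  ~~ sink o v -> forall a, adj v a -> psi v a = pr a v *m ev).
  move=> v; case: (boolP (~~ sink o v && reduced v)) => [/andP [sv rv]|nv]; last first.
    by exists 0 => sv a /adj_reduced [rv _]; rewrite sv rv in nv.
  have [|w wP] := pr_source_factor sv rv (u := psi v); last by exists w.
  rewrite -(@sum_nbrs_support _ S v) //; [by rewrite -/(U v) UV V0|move=> a|move=> a nva].
    by move=> /(contraNN (AS a)); rewrite negbK => /eqP a0; rewrite (@mx0l _ _ _ (psi v a) 0 a0) mulmx0.
  by rewrite (module_map0 mA) ?mul0mx // /arrow (negbTE nva).
have [|e' eP'] := @dep_choice _ (fun v => 'M[k]_(rdim C v, rdim X v)) (fun v ev =>
  (~~ sink o v -> ev = e v) /\
  (sink o v -> forall y, adj v y -> e y *m rmap X y v = rmap C y v *m ev)).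
  move=> v; case: (boolP (sink o v)) => sv; last by exists (e v); split.
  case: (boolP (reduced v)) => rv; last first.
    by exists 0; split=> // _ y /adj_reduced [rv' _]; rewrite rv' in rv.
  have [|w wP] := pr_sink_factor sv rv (u := fun y => e y *m rmap X y v); last by exists w; split.
  have VS : \sum_(y <- nbrs v) psi y v *m rmap X y v = 0.
    rewrite -(@sum_nbrs_support _ S v) //; [by rewrite -/(V v) -UV U0|move=> y|move=> y nva].
      by move=> /(contraNN (XS y)); rewrite negbK => /eqP a0; rewrite (@mx0r _ _ _ (psi y v) 0 a0) mul0mx.
    by rewrite (module_map0 mX) ?mulmx0 // /arrow adjC (negbTE nva).
  rewrite -[RHS]VS [LHS]big_seq [RHS]big_seq; apply: eq_bigr => y; rewrite mem_nbrs // => vy.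
  by rewrite (eP y) ?mulmxA // ?(sink_adj _ vy) ?sv // adjC.
have srcE v : ~~ sink o v -> e' v = e v by case: (eP' v).
exists e' => [y a /andP [ya sa]|y a /andP [ya sa]].
  have sy : ~~ sink o y by rewrite -(sink_adj _ ya).
  by have [_ /(_ sa y) <-] := eP' a; rewrite ?srcE // adjC.
have sy : ~~ sink o y by rewrite -(sink_adj _ ya).
by rewrite srcE // eP.
Qed.

(** If the pullback along [p] is no coboundary, separation gives [psi], which comes from some
    [e : C -> X]. The form behind [t] is then nonzero at the composite of [e] and [p]; hence this
    composite is invertible and [p] splits. *)
Lemma exists_right_almost_split : exists t : cochain C A, right_almost_split o t.
Proof.
have [S0 [uS0 CS0 AS0]] := support_list.
have [t [t0 tE tn]] := dual_cochain uS0 CS0 AS0.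
exists t; split=> //; first exact: dual_cochain_not_coboundary tn.
move=> X p mX hp nsp; apply: NNPP => ncb.
have [_ [sX fX] _] := mX.
pose S := undup (S0 ++ sX); have uS : uniq S by apply: undup_uniq.
have CS x : rdim C x != 0%N -> x \in S by move/CS0; rewrite mem_undup mem_cat => ->.
have AS x : rdim A x != 0%N -> x \in S by move/AS0; rewrite mem_undup mem_cat => ->.
have XS x : rdim X x != 0%N -> x \in S.
  by move/fX; rewrite mem_undup mem_cat => ->; rewrite orbT.
pose L := [seq (y, a) | y <- S, a <- S].
pose I : eqType := (seq 'I_n * seq 'I_n)%type.
have [||||| psi [psi0 psi1]] := @trace_form_separation k I L
    (fun i => rdim X i.1) (fun i => rdim A i.2)
    (fun z => exists h : mor X A, forall i, i \in L ->
       z i = h i.1 *m rmap A i.1 i.2 - rmap X i.1 i.2 *m h i.2)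
    (fun i => p i.1 *m t i.1 i.2).
- by apply: allpairs_uniq => // -[y a] [y' a'] _ _ [-> ->].
- by exists (fun _ => 0) => i _; rewrite mulmx0 mul0mx subrr.
- move=> c z z' [h hE] [h' hE']; exists (fun x => c *: h x + h' x) => i iL.
  rewrite hE // hE' // mulmxDl mulmxDr -!scalemxAl -!scalemxAr scalerBr.
  by rewrite opprD addrACA.
- by move=> z z' zz' [h hE]; exists h => i iL; rewrite -zz' // hE.
- case=> h hE; apply: ncb; exists h => y a ya.
  case: (boolP ((y, a) \in L)) => [/hE //|nL].
  have : (y \notin S) || (a \notin S).
    by rewrite -negb_and; apply: contraNN nL => /andP [yS aS]; apply: allpairs_f.
  case/orP => /contraNN; [move/(_ _ (XS y))|move/(_ _ (AS a))]; rewrite negbK => /eqP d0.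
    exact: mx0l.
  exact: mx0r.
have [|e he eE] := @annihilator_hom S X (fun y a => psi (y, a)) mX uS AS XS.
  move=> h; rewrite -[RHS](psi0 (fun i => h i.1 *m rmap A i.1 i.2 - rmap X i.1 i.2 *m h i.2)).
    by rewrite big_allpairs_dep.
  by exists h.
have nie : ~ invertible (hcomp e p).
  move=> iv; apply: nsp; have hi := invertible_hom (hcomp_hom he hp) iv.
  exists (hcomp (fun a => invmx (hcomp e p a)) e); split; first exact: hcomp_hom.
  by move=> a; rewrite /hcomp -mulmxA mulVmx //; apply: iv.
move/eqP: psi1; apply.
rewrite big_allpairs_dep /= -[RHS](tE _ (hcomp_hom he hp) nie).
transitivity (\sum_(y <- S) \sum_(a <- S) \tr (pr a y *m hcomp e p y *m t y a)).
  apply: eq_bigr => y _; apply: eq_bigr => a _; case: (boolP (arrow o y a)) => ya.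
    by rewrite (eE _ _ ya) mxtrace_mulC !mulmxA.
  by rewrite t0 // !mulmx0 mul0mx !raddf0.
have z1 y a : rdim C y = 0%N -> \tr (pr a y *m hcomp e p y *m t y a) = 0.
  by move=> d0; rewrite (@mx0l _ _ _ (t y a) 0 d0) mulmx0 raddf0.
have z2 y a : rdim A a = 0%N -> \tr (pr a y *m hcomp e p y *m t y a) = 0.
  by move=> d0; rewrite (@mx0l _ _ _ (pr a y) 0 d0) !mul0mx raddf0.
have notin (F : rep k n) T x : (forall x, rdim F x != 0%N -> x \in T) -> x \notin T -> rdim F x = 0%N.
  by move=> FT; apply: contraNeq; apply: FT.
(* [t] was built over [S0], before [X] was given; the summands vanish off the supports of [C] and
   [A], so [S] may be shrunk to [S0]. *)
transitivity (\sum_(y <- S0) \sum_(a <- S) \tr (pr a y *m hcomp e p y *m t y a)).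
  apply: big_uniq_support => // y yS; rewrite big1 // => a _; apply: z1.
    exact: notin CS yS.
  exact: notin CS0 yS.
apply: eq_bigr => y _; apply: big_uniq_support => // a aS; apply: z2.
  exact: notin AS aS.
exact: notin AS0 aS.
Qed.

End Existence.

End AlmostSplit.

(** * Extensions and irreducible maps *)

Section AlmostSplitSequences.
Variables (k : fieldType) (n : nat).
Implicit Types (M N X Y C A B : rep k n) (o : bool) (a x y : seq 'I_n).

(** The conditions on [pr] at sinks are the exactness of the first link; those at sources are the
    exactness of the second and sink-freeness of [B]. *)
Lemma linked_right_almost_split o C B A : linked o C B -> linked (~~ o) B A ->
  exists t : cochain C A, right_almost_split o t.
Proof.
move=> L1 L2.
have [mC mB kC _] := linked_strict L1; have [_ mA kB _] := linked_strict L2.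
rewrite negbK in mA.
have snk a : sink o a -> ~~ sink (~~ o) a by rewrite sinkN negbK.
have src y : ~~ sink o y -> sink (~~ o) y by rewrite sinkN.
pose pr a y := lof L2 a *m rmap B a y *m lof L1 y.
apply: (exists_right_almost_split (pr := pr) mC mA (linked_indl L1) kC).
- move=> a y nya; rewrite /pr (module_map0 mB) ?mulmx0 ?mul0mx //.
  apply: contraNN nya => /andP [ay]; rewrite /arrow adjC ay sinkN.
  by rewrite (sink_adj _ ay) negbK.
- move=> a sa ra; rewrite -[RHS](mulmx0 _ (lof L2 a)) -(link_comp0 L1 sa ra) mulmx_sumr.
  by apply: eq_bigr => y _; rewrite !mulmxA.
- move=> y sy ry; rewrite -[RHS](mul0mx _ (lof L1 y)) -(link_comp0 L2 (src _ sy) ry) mulmx_suml.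
  by apply: eq_bigr => a _; rewrite !mulmxA.
- move=> y sy ry d u u0.
  have adj_sink a : adj y a -> ~~ sink (~~ o) a.
    by move=> ya; rewrite sinkN negbK (sink_adj _ ya).
  have [|w wP] := link_coker L2 (src _ sy) ry (u := fun a => lto L2 a *m u a).
    rewrite -[RHS]u0 [LHS]big_seq [RHS]big_seq; apply: eq_bigr => a; rewrite mem_nbrs // => ya.
    by rewrite !mulmxA -(mulmxA _ (lof L2 a)) lofK ?adj_sink // mulmx1.
  exists (lto L1 y *m w) => a ya; rewrite -[LHS]mul1mx -(lofK L2 (adj_sink _ ya)).
  rewrite -mulmxA wP // /pr !mulmxA -(mulmxA _ (lof L1 y)).
  by rewrite lofK // mulmx1.
- move=> y sy ry d w w0; rewrite -[w]mul1mx -(ltoK L1 sy) -mulmxA.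
  suff -> : lof L1 y *m w = 0 by rewrite mulmx0.
  apply: (kB _ _ _ (src _ sy) ry) => a ya.
  have sa : ~~ sink (~~ o) a by rewrite sinkN negbK (sink_adj _ ya).
  rewrite -[LHS]mul1mx -(ltoK L2 sa) -mulmxA; have := w0 a ya.
  by rewrite /pr -!mulmxA => ->; rewrite mulmx0.
- move=> a sa ra d u u0; have [|w wP] := link_coker L1 sa ra (u := u); last by exists w.
  rewrite -[LHS]mul1mx -(ltoK L2 (snk _ sa)) -mulmxA.
  suff -> : lof L2 a *m \sum_(y <- nbrs a) rmap B a y *m lof L1 y *m u y = 0 by rewrite mulmx0.
  by rewrite mulmx_sumr -[RHS]u0; apply: eq_bigr => y _; rewrite /pr !mulmxA.
Qed.

(** With row vectors the first block is the submodule [Y], the second the quotient [C]. *)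
Definition extension Y C (t : cochain C Y) : rep k n :=
  @Rep k n (fun x => rdim Y x + rdim C x)%N
    (fun x y => block_mx (rmap Y x y) 0 (t x y) (rmap C x y)).

Section Extension.
Variables (o : bool) (Y C : rep k n) (t : cochain C Y).
Hypotheses (mY : is_module o Y) (mC : is_module o C).
Hypothesis t0 : forall y a, ~~ arrow o y a -> t y a = 0.

Lemma extension_module : is_module o (extension t).
Proof.
have [rY [s fs] Y0] := mY; have [rC [s' fs'] C0] := mC; split.
- by move=> a; rewrite /= addn_eq0 negb_and => /orP [/rY|/rC].
- exists (s ++ s') => a; rewrite /= addn_eq0 negb_and mem_cat.
  by case/orP => [/fs|/fs'] ->; rewrite ?orbT.
- by move=> x y nxy; rewrite /= t0 // Y0 // C0 // block_mx0.
Qed.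

Definition extension_proj : mor (extension t) C := fun x => col_mx 0 1%:M.
Definition extension_incl : mor Y (extension t) := fun x => row_mx 1%:M 0.

Lemma extension_proj_hom : is_hom o extension_proj.
Proof.
move=> x y _; rewrite /extension_proj /= mul_block_col mul_col_mx.
by rewrite !mulmx0 !mul0mx mulmx1 mul1mx !add0r.
Qed.

Lemma extension_incl_hom : is_hom o extension_incl.
Proof.
move=> x y _; rewrite /extension_incl /= mul_row_block mul_mx_row.
by rewrite !mulmx0 !mul0mx mulmx1 mul1mx !addr0.
Qed.

Lemma extension_proj_split : split_epi o extension_proj -> coboundary o t.
Proof.
case=> s [hs sE]; exists (fun x => - lsubmx (s x)) => y a ya.
have s2 x : rsubmx (s x) = 1%:M.
  by have := sE x; rewrite -{1}[s x]hsubmxK mul_row_col mulmx0 mulmx1 add0r.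
have := hs _ _ ya; rewrite -{1}[s a]hsubmxK -{1}[s y]hsubmxK mul_mx_row mul_row_block.
case/eq_row_mx => E _.
by rewrite mulNmx mulmxN opprK E s2 mul1mx addrA addNr add0r.
Qed.

Lemma extension_incl_split : split_mono o extension_incl -> coboundary o t.
Proof.
case=> s [hs sE]; exists (fun x => dsubmx (s x)) => y a ya.
have s1 x : usubmx (s x) = 1%:M.
  by have := sE x; rewrite -{1}[s x]vsubmxK mul_row_col mul0mx mul1mx addr0.
have := hs _ _ ya; rewrite -{1}[s a]vsubmxK -{1}[s y]vsubmxK mul_block_col mul_col_mx.
case/eq_col_mx => _; rewrite s1 mulmx1 => <-.
by rewrite addrK.
Qed.

End Extension.

Lemma coboundary_comp o X Y (t : cochain X Y) (g : mor Y Y) : is_hom o g ->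
  coboundary o t -> coboundary o ((fun x y => t x y *m g y) : cochain X Y).
Proof.
move=> hg [h hE]; exists (hcomp h g) => y a ya.
by rewrite hE // mulmxBl /hcomp -!mulmxA hg.
Qed.

(* Apply the right almost split property to the pushout of the extension along u. *)
Lemma left_almost_split o C A (t : cochain C A) Y (u : mor A Y) :
  is_module o C -> is_module o A -> indecomposable o A -> is_module o Y ->
  right_almost_split o t -> is_hom o u -> ~ split_mono o u ->
  coboundary o ((fun x y => t x y *m u y) : cochain C Y).
Proof.
move=> mC mA iA mY [t0 nt ras] hu nsu; apply: NNPP => ncb.
pose tu : cochain C Y := fun x y => t x y *m u y.
have tu0 y a : ~~ arrow o y a -> tu y a = 0 by move=> /t0; rewrite /tu => ->; rewrite mul0mx.
have [|h hE] := ras _ (extension_proj tu) (extension_module mY mC tu0) (@extension_proj_hom o _ _ tu).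
  by move/extension_proj_split.
pose h1 : mor Y A := fun x => usubmx (h x); pose h2 : mor C A := fun x => dsubmx (h x).
have hE2 y a : arrow o y a ->
    0 = h1 y *m rmap A y a - rmap Y y a *m h1 a /\
    t y a = h2 y *m rmap A y a - (tu y a *m h1 a + rmap C y a *m h2 a).
  move/hE; rewrite /extension_proj /= -{1}[h y]vsubmxK -{1}[h a]vsubmxK.
  rewrite mul_block_col !mul_col_mx opp_col_mx add_col_mx => /eq_col_mx [].
  by rewrite !mul0mx mul1mx addr0.
have hh1 : is_hom o h1.
  by move=> x y /hE2 [/eqP + _]; rewrite eq_sym subr_eq0 => /eqP ->.
(* By [hE2], [t] followed by 1 + [hcomp u h1] is a coboundary. As [u] does not split, locality of
   End(A) makes this factor invertible, and [t] would be a coboundary. *)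
have hx : is_hom o ((fun x => - hcomp u h1 x) : mor A A).
  by move=> x y axy; rewrite mulmxN mulNmx (hcomp_hom hu hh1).
have nix : ~ invertible ((fun x => - hcomp u h1 x) : mor A A).
  move=> iv; apply: nsu; have hg := invertible_hom hx iv.
  exists (fun x => h1 x *m - invmx (- hcomp u h1 x)); split.
    move=> x y axy; rewrite mulmxA hh1 // -!mulmxA; congr (_ *m _).
    by rewrite mulmxN mulNmx hg.
  by move=> x; rewrite mulmxA mulmxN -mulNmx mulmxV //; apply: iv.
have ix := invertible_sub1 mA iA hx nix; set x1 : mor A A := (X in invertible X) in ix.
have hx1 : is_hom o x1.
  by move=> x y axy; rewrite /x1 mulmxBr mulmxBl hx // mulmx1 mul1mx.
apply: nt; have hg := invertible_hom hx1 ix.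
suff cb : coboundary o ((fun y a => t y a *m x1 a) : cochain C A).
  have [h3 h3E] := coboundary_comp hg cb; exists h3 => y a ya.
  by rewrite -h3E // -mulmxA mulmxV ?mulmx1 //; apply: ix.
exists h2 => y a ya; have [_ tE] := hE2 _ _ ya.
rewrite /x1 opprK mulmxDr mulmx1 {1}tE /tu /hcomp -!mulmxA opprD addrA.
by rewrite addrAC -!addrA addNr addr0.
Qed.

(** [f] extends over the middle term; the inclusion of [A] does not split, so irreducibility makes
    [N] a summand of the middle term. *)
Lemma irreducible_from_dim o C A (t : cochain C A) N (f : mor A N) :
  is_module o C -> is_module o A -> indecomposable o A -> is_module o N ->
  right_almost_split o t -> irreducible o f ->
  forall x, rdim N x != 0%N -> rdim A x != 0%N \/ rdim C x != 0%N.
Proof.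
move=> mC mA iA mN ras [hf nsm nse fac] x nx; have [t0 nt _] := ras.
have [h hE] := left_almost_split mC mA iA mN ras hf nsm.
pose g : mor (extension t) N := fun x => col_mx (f x) (h x).
have hg : is_hom o g.
  move=> y a ya; rewrite /g /= mul_block_col mul_col_mx mul0mx addr0 hf //.
  by rewrite hE // subrK.
have fE y : f y = extension_incl t y *m g y.
  by rewrite /extension_incl /g mul_row_col mul1mx mul0mx addr0.
case: (fac _ _ g (extension_module mA mC t0) (@extension_incl_hom o _ _ t) hg fE).
  by move/extension_incl_split.
move/split_epi_epic/epic_dim => /(_ x nx) /=.
by rewrite addn_eq0 negb_and => /orP.
Qed.

(** [f] lifts to a split monomorphism [g] into the middle term; the component [r1] of its retraction
    on [A] is the new irreducible map. *)
Lemma irreducible_to o C A (t : cochain C A) N (f : mor N C) :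
  is_module o C -> is_module o A -> indecomposable o A -> is_module o N ->
  indecomposable o N -> right_almost_split o t -> irreducible o f ->
  (forall x, rdim N x != 0%N -> rdim A x != 0%N \/ rdim C x != 0%N) /\
  exists g : mor A N, irreducible o g.
Proof.
move=> mC mA iA mN iN ras [hf nsm nse fac]; have [t0 nt rasp] := ras.
have [h hE] := rasp _ f mN hf nse.
pose g : mor N (extension t) := fun x => row_mx (- h x) (f x).
have hg : is_hom o g.
  move=> y a ya; rewrite /g /= mul_row_block mul_mx_row mulmx0 add0r hf //; congr row_mx.
  by rewrite hE // mulNmx mulmxN addrA addNr add0r.
have fE y : f y = g y *m extension_proj t y.
  by rewrite /extension_proj /g mul_row_col mulmx1 mulmx0 add0r.
case: (fac _ g _ (extension_module mA mC t0) hg (@extension_proj_hom o _ _ t) fE); last first.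
  by move/extension_proj_split.
move=> smg; split.
  move=> x nx; have := monic_dim (split_mono_monic smg) nx.
  by rewrite /= addn_eq0 negb_and => /orP.
have [r [hr gr]] := smg.
pose r1 : mor A N := fun x => usubmx (r x); pose r2 : mor C N := fun x => dsubmx (r x).
have rE y a : arrow o y a ->
    rmap A y a *m r1 a = r1 y *m rmap N y a /\
    t y a *m r1 a + rmap C y a *m r2 a = r2 y *m rmap N y a.
  move/hr; rewrite -{1}[r y]vsubmxK -{1}[r a]vsubmxK mul_block_col mul_col_mx.
  by case/eq_col_mx; rewrite mul0mx addr0.
have hr1 : is_hom o r1 by move=> y a /rE [].
have id1 x : f x *m r2 x - h x *m r1 x = 1%:M.
  by rewrite -(gr x) -{1}[r x]vsubmxK /g mul_row_col mulNmx addrC.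
have nsm1 : ~ split_mono o r1.
  case=> w [hw rw]; apply: nt; have [l lE] : coboundary o ((fun x y => t x y *m r1 y) : cochain C N).
    by exists r2 => y a ya; have [_ <-] := rE _ _ ya; rewrite addrK.
  exists (hcomp l w) => y a ya; rewrite -[t y a]mulmx1 -rw mulmxA lE // mulmxBl /hcomp.
  by rewrite -!mulmxA hw.
exists r1; split=> //.
- case=> w [hw wr]; have [_ indA] := iA.
  case: (indA (hcomp r1 w) (hcomp_hom hr1 hw)) => [x|z|o1].
  + by rewrite /hcomp mulmxA -(mulmxA _ (w x)) wr mulmx1.
  + have [[b /(dim_neq0P k) nb] _] := iN; apply: nb; rewrite -(wr b).
    have zb : r1 b *m w b = 0 := z b.
    by rewrite -[r1 b]mulmx1 -(wr b) (mulmxA (r1 b)) zb mul0mx mulmx0.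
  + by apply: nsm1; exists w.
move=> X u v mX hu hv uvE; case: (classic (split_mono o u)) => su; [by left|right].
have [l lE] := left_almost_split mC mA iA mX ras hu su.
(* The correction by [l] makes [c] and [m] homomorphisms, and [id1] becomes 1 = fc + mv. Since [f]
   is not a split mono, fc is a nonunit; so mv is invertible and [v] splits. *)
pose c : mor C N := fun x => r2 x - l x *m v x.
have hc : is_hom o c.
  move=> y a ya; have [_ E] := rE _ _ ya; rewrite /c mulmxBr mulmxBl -E uvE mulmxA lE //.
  rewrite mulmxBl -!mulmxA hv // [in RHS]addrAC addrC; congr (_ + _).
  by rewrite addrAC subrr add0r.
pose m : mor N X := fun x => f x *m l x - h x *m u x.
have hm : is_hom o m.
  move=> y a ya; rewrite /m mulmxBr mulmxBl !mulmxA hf //.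
  have -> : rmap N y a *m h a = h y *m rmap A y a - f y *m t y a.
    by rewrite hE // opprB addrC subrK.
  rewrite mulmxBl -!mulmxA hu // lE // mulmxBr opprB addrA; congr (_ - _).
  by rewrite addrC subrK.
have hfc := hcomp_hom hf hc.
have nfc : ~ invertible (hcomp f c).
  move=> iv; apply: nsm; have hi := invertible_hom hfc iv.
  exists (hcomp c (fun a => invmx (hcomp f c a))); split; first exact: hcomp_hom.
  by move=> x; rewrite /hcomp mulmxA mulmxV //; apply: iv.
have iv := invertible_sub1 mN iN hfc nfc; set x1 : mor N N := (X in invertible X) in iv.
have x1E x : x1 x = m x *m v x.
  rewrite /x1 /hcomp /c /m -(id1 x) uvE mulmxBr mulmxBl !mulmxA opprB.
  by rewrite addrC addrA subrK.
have hx1 : is_hom o x1.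
  by move=> x y axy; rewrite /x1 mulmxBr mulmxBl hfc // mulmx1 mul1mx.
have hi := invertible_hom hx1 iv.
exists (hcomp (fun a => invmx (x1 a)) m); split; first exact: hcomp_hom.
by move=> x; rewrite /hcomp -mulmxA -x1E mulVmx //; apply: iv.
Qed.

End AlmostSplitSequences.

(** * The index *)

Section Paths.
Variable n : nat.
Implicit Types (x y z : seq 'I_n) (p q : seq (seq 'I_n)).

(** If the last edge turned back towards [x], the four-point condition would identify its end with
    the vertex before [w], which is already on the path. *)
Lemma path_dist x p : path (@adj n) x p -> uniq (x :: p) ->
  dist x (last x p) = size p.
Proof.
have [m] := ubnP (size p); elim: m p => // m IH p.
case/lastP: p => [|q z]; first by rewrite distxx.
rewrite size_rcons ltnS rcons_path last_rcons -rcons_cons rcons_uniq.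
move=> qm /andP [pq az] /andP [nz uq].
have dq := IH q qm pq uq; case/lastP: q => [|q w] in qm pq az nz uq dq *.
  by rewrite /= in az *; apply: adj_dist1.
move: pq uq dq az nz; rewrite size_rcons rcons_path last_rcons -rcons_cons rcons_uniq.
move=> /andP [pq aw] /andP [nw uq] dw wz nz.
have dq : dist x (last x q) = size q by apply: IH => //; rewrite size_rcons in qm; lia.
have [-> |dz] := adj_dist x wz; first by rewrite dw.
case/negP: nz; rewrite rcons_cons in_cons mem_rcons in_cons orbCA -in_cons.
suff -> : z = last x q by rewrite mem_last orbT.
apply: dist_eq0; have := dist_four x w z (last x q).
rewrite (adj_dist1 wz) (distC w) (adj_dist1 aw); lia.
Qed.

End Paths.

(** * Supports, sink modules and the position of the index *)

Section Supports.
Variables (k : fieldType) (n : nat).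
Implicit Types (M : rep k n) (o : bool) (x y : seq 'I_n).

Lemma tpath_dist M x p : tpath M (x :: p) -> dist x (last x p) = size p.
Proof. by case/and4P => _ u _ s; apply: path_dist. Qed.

(** The indicator of the component of [x] is an idempotent endomorphism, nonzero at [x], hence the
    identity. *)
Lemma indecomposable_connected o M x y : indecomposable o M ->
  rdim M x != 0%N -> rdim M y != 0%N ->
  exists p, tpath M (x :: p) /\ last x p = y.
Proof.
move=> [_ ind] nx ny.
pose reach z := exists p, [/\ path (@adj n) x p,
  all (fun a => rdim M a != 0%N) (x :: p) & last x p = z].
have reach_step u v : adj u v -> rdim M v != 0%N -> reach u -> reach v.
  move=> uv nv [p [pp ap lp]]; exists (rcons p v).
  by rewrite rcons_path lp pp uv last_rcons -rcons_cons all_rcons nv.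
suff [p [pp ap <-]] : reach y.
  case: (shortenP pp) => p' pp' up' sub; exists p'; split=> //.
  have [/= nx' ap2] := andP ap; rewrite /tpath up' /= pp' nx' !andbT.
  by apply/allP => z /sub /(allP ap2).
pose e : mor M M := fun a =>
  if excluded_middle_informative (reach a) is left _ then 1%:M else 0.
have he : is_hom o e.
  move=> u v /andP [uv _]; rewrite /e.
  case: (eqVneq (rdim M u) 0%N) => [u0|nu]; first exact: mx0l.
  case: (eqVneq (rdim M v) 0%N) => [v0|nv]; first exact: mx0r.
  case: excluded_middle_informative => rv; case: excluded_middle_informative => ru.
  - by rewrite mulmx1 mul1mx.
  - by case: ru; apply: reach_step rv; rewrite // adjC.
  - by case: rv; apply: reach_step ru.
  - by rewrite mulmx0 mul0mx.
case: (ind e he) => [a|e0|e1].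
- by rewrite /e; case: excluded_middle_informative; rewrite ?mulmx1 ?mulmx0.
- have := e0 x; rewrite /e; case: excluded_middle_informative => [_|[]].
    by move/(dim_neq0P k): nx.
  by exists [::]; rewrite /= nx.
- have := e1 y; rewrite /e; case: excluded_middle_informative => // _ /esym.
  by move/(dim_neq0P k): ny.
Qed.

Lemma indecomposable_diam_dist o M d x y : indecomposable o M -> is_diam M d ->
  rdim M x != 0%N -> rdim M y != 0%N -> (dist x y <= d)%N.
Proof.
move=> ind [_ bd] nx ny; have [p [tp <-]] := indecomposable_connected ind nx ny.
by rewrite (tpath_dist tp); apply: (bd _ tp).
Qed.

Lemma is_diam_inj M d d' : is_diam M d -> is_diam M d' -> d = d'.
Proof.
move=> [[p [tp sp]] bd] [[p' [tp' sp']] bd'].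
by have := bd _ tp'; have := bd' _ tp; rewrite sp sp'; lia.
Qed.

Lemma sink_module_ball o M : indecomposable o M -> sink_module o M ->
  (forall x, sink o x -> rdim M x != 0%N -> exists2 y, adj x y & rdim M y != 0%N) ->
  exists c, exists2 r, is_diam M (2 * r) & sink_ball o (rdim M) c r.
Proof.
move=> ind [d [dd ends]] nbr; have [[p0 [tp sp]] bd] := dd; case: p0 tp sp => // x p tp [sp].
have := ends _ tp; rewrite /= sp => /(_ erefl) /andP [sx sy].
have dxy := tpath_dist tp; rewrite sp in dxy.
have [r dr] : exists r, d = (2 * r)%N.
  exists d./2; rewrite mul2n -[LHS]odd_double_half -dxy odd_dist.
  by move: sx sy; rewrite /sink => /eqP -> /eqP ->; rewrite addbb.
have [_ u /allP ap /= pp] := and4P tp.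
have nx : rdim M x != 0%N by apply: ap; rewrite mem_head.
have ny : rdim M (last x p) != 0%N by apply: ap; apply: mem_last.
have rp : (r <= size p)%N by rewrite sp dr; lia.
pose c := last x (take r p).
have [cp1 cp2] : path (@adj n) x (take r p) /\ path (@adj n) c (drop r p).
  by apply/andP; rewrite -cat_path cat_take_drop.
have u1 : uniq (x :: take r p).
  by move: u; rewrite -{1}(cat_take_drop r p) -cat_cons cat_uniq => /and3P [].
have u2 : uniq (c :: drop r p).
  move: u; rewrite -{1}(cat_take_drop r p) -cat_cons cat_uniq => /and3P [_ h d2].
  rewrite /= d2 andbT; apply: contra h => cd; apply/hasP; exists c => //.
  exact: mem_last.
have dxc : dist x c = r by rewrite (path_dist cp1 u1) size_takel.
have dcy : dist c (last x p) = r.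
  have -> : last x p = last c (drop r p) by rewrite -last_cat cat_take_drop.
  by rewrite (path_dist cp2 u2) size_drop sp dr; lia.
exists c, r; first by rewrite -dr.
split.
- rewrite lt0n; apply/eqP => r0; have [y xy my] := nbr x sx nx.
  have := indecomposable_diam_dist ind dd nx my; rewrite (adj_dist1 xy) dr r0; lia.
- move: sx; rewrite /sink -dxc odd_dist => /eqP <-.
  by case: (odd _); case: (odd _).
- move=> z nz; have := dist_four c z x (last x p).
  have := indecomposable_diam_dist ind dd nz nx; have := indecomposable_diam_dist ind dd nz ny.
  by rewrite (distC c x) dxc dcy dxy dr; lia.
- by exists x, (last x p); rewrite distC dxy dr.
Qed.

Lemma sink_ball_module o M c r : indecomposable o M ->
  sink_ball o (rdim M) c r -> sink_module o M /\ is_diam M (2 * r).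
Proof.
move=> ind [r0 par sub [p] [q] [np nq cp cq pq]].
have ends x s : tpath M (x :: s) -> (dist c x <= r)%N /\ (dist c (last x s) <= r)%N.
  by case/and4P => _ _ /allP a _; split; apply: sub; apply: a; rewrite ?mem_head ?mem_last.
have dd : is_diam M (2 * r).
  split.
    have [s [ts ls]] := indecomposable_connected ind np nq.
    by exists (p :: s); split=> //=; rewrite -(tpath_dist ts) ls pq.
  case=> // x s ts; have [h1 h2] := ends _ _ ts; rewrite /= -(tpath_dist ts) ltnS.
  by have := dist_tri x c (last x s); rewrite (distC x c); lia.
split=> //; exists (2 * r)%N; split=> //; case=> // x s ts [ss].
have [h1 h2] := ends _ _ ts; have := dist_tri x c (last x s).
rewrite (tpath_dist ts) ss (distC x c) => h.
have e1 : dist c x = r by lia.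
have e2 : dist c (last x s) = r by lia.
by rewrite /= !(sink_dist _ par) e1 e2 eqxx.
Qed.

(** The reflection formula determines each of two consecutive members from the other, so an
    agreement at 0 spreads both ways. *)
Lemma dim_orbit_periodic o (D : int -> seq 'I_n -> nat) u : dim_orbit o D ->
  orient o u = o -> (forall x, D 0 x = D u x) -> forall i x, D i x = D (i + u) x.
Proof.
move=> [red eqD eqS] ou e0.
have oE i : orient o (i + u) = orient o i by rewrite addrC orientD ou.
have nred i x : ~~ reduced x -> D i x = 0%N.
  by move=> nx; apply/eqP; apply: contraNT nx; apply: red.
have up i : (forall x, D i x = D (i + u) x) -> forall x, D (i + 1) x = D (i + 1 + u) x.
  move=> IH x; rewrite -addrA (addrC 1) addrA.
  case: (boolP (reduced x)) => rx; last by rewrite !nred.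
  case: (boolP (sink (orient o i) x)) => sx; last by rewrite !eqD ?oE.
  have h1 := eqS i x rx sx; have := eqS (i + u) x rx; rewrite oE => /(_ sx) h2.
  apply: (@addIn (D i x)); rewrite h1 IH h2; exact: eq_bigr.
have down i : (forall x, D (i + 1) x = D (i + 1 + u) x) -> forall x, D i x = D (i + u) x.
  move=> IH x; have {}IH y : D (i + 1) y = D (i + u + 1) y.
    by rewrite IH -addrA (addrC 1) addrA.
  case: (boolP (reduced x)) => rx; last by rewrite !nred.
  have src y : ~~ sink (orient o i) y -> D i y = D (i + u) y.
    by move=> sy; rewrite -(eqD i) // -(eqD (i + u)) ?oE // IH.
  case: (boolP (sink (orient o i) x)) => sx; last exact: src.
  have h1 := eqS i x rx sx; have := eqS (i + u) x rx; rewrite oE => /(_ sx) h2.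
  apply: (@addnI (D (i + 1) x)); rewrite h1 IH h2.
  rewrite [LHS]big_seq [RHS]big_seq; apply: eq_bigr => y; rewrite mem_nbrs // => xy.
  by apply: src; rewrite (sink_adj _ xy) sx.
have base x : D 0 x = D (0 + u) x by rewrite add0r.
case=> m.
  elim: m => // m IH; rewrite (_ : Posz m.+1 = Posz m + 1); [exact: up|lia].
elim: m => [|m IH]; apply: down; first by rewrite (_ : Negz 0 + 1 = 0).
by rewrite (_ : Negz m.+1 + 1 = Negz m) //; lia.
Qed.

Hypothesis n_ge3 : (2 < n)%N.

(** A sink ball at s + 1 would be smaller than the one at s, against minimality. The definition of
    the index only makes M isomorphic to its shift by s + t; this number is 0, since growing balls
    are incompatible with periodic dimensions. *)
Lemma index_last_sink o M t : is_module o M -> indecomposable o M -> regular o M ->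
  index_is o M t -> exists c r,
    let D i := rdim (sig_pow o i M) in
    sink_ball (orient o (- t)) (D (- t)) c r /\
    forall c' r', ~ sink_ball (orient o (- t + 1)) (D (- t + 1)) c' r'.
Proof.
move=> mM iM rM [s /= [smod [r0 [rad rmin]] isoM]].
have orb := sig_pow_orbit mM iM rM; have dorb := orbit_dim orb.
have ind i := orbit_indecomposable i orb.
have [c [r dr sb]] : exists c, exists2 r, is_diam (sig_pow o s M) (2 * r) &
    sink_ball (orient o s) (rdim (sig_pow o s M)) c r.
  apply: (sink_module_ball (ind s) smod) => x sx nx.
  by apply: (dim_orbit_nbr dorb sx); move: nx; lia.
have r0E : r0 = r.
  case: rad => d [dd ->]; rewrite (is_diam_inj dd dr); lia.
have nsb c' r' : ~ sink_ball (orient o (s + 1)) (rdim (sig_pow o (s + 1) M)) c' r'.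
  move=> sb'; have [smod' dr'] := sink_ball_module (ind (s + 1)) sb'.
  have := rmin (s + 1) r' smod'; rewrite r0E => /(_ _) H.
  have : (r <= r')%N by apply: H; exists (2 * r')%N; split=> //; lia.
  have [_ dr2] := sink_ball_module (ind s) (sink_ball_prev dorb n_ge3 sb').
  by have := is_diam_inj dr dr2; lia.
suff st : s + t = 0 by exists c, r; rewrite (_ : - t = s); [split|lia].
have [_ isoA] := sig_pow_orbit_iso s t orb.
have ou : orient o (s + t) = o by rewrite orientD; case: isoM.
have e0 x : rdim (sig_pow o 0 M) x = rdim (sig_pow o (s + t) M) x.
  by rewrite -(iso_dim _ isoA); apply: (iso_dim _ isoM).
have per := dim_orbit_periodic dorb ou e0.
apply/eqP; apply: contraT => u0.
have [_ _ sub _] := sb.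
have [_ _ _ [p [_ [np _ cp _ _]]]] := sink_ball_down dorb n_ge3 `|(s + t)%R|%N sb.
suff : rdim (sig_pow o s M) p != 0%N by move/sub; rewrite cp; move: u0; lia.
have [ust|[ust|ust]] : s + t < 0 \/ s + t = 0 \/ 0 < s + t by lia.
- by rewrite per (_ : s + (s + t) = s - `|(s + t)%R|%N%:Z) //; lia.
- by rewrite ust eqxx in u0.
- have := np; rewrite per (_ : s - `|(s + t)%R|%N%:Z + (s + t) = s) //; lia.
Qed.

(** If s + 1 < s', descending from s' gives a sink ball of [B] at s + 2, which [sink_ball_step]
    forbids; its inclusions come from the almost split extensions in both orbits. *)
Lemma orbit_index_le o (A B : int -> rep k n) (f : mor (A 0) (B 0)) s s' c c' r r' :
  orbit o A -> orbit o B -> irreducible o f ->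
  sink_ball (orient o s) (rdim (A s)) c r ->
  (forall c1 r1, ~ sink_ball (orient o (s + 1)) (rdim (A (s + 1))) c1 r1) ->
  sink_ball (orient o s') (rdim (B s')) c' r' -> (s' <= s + 1).
Proof.
move=> oA oB irr sb nsb sb'; have [//|lt] : (s' <= s + 1) \/ (s + 1 < s') by lia.
exfalso.
have irrj := orbit_irreducible oA oB irr.
have sb2 : sink_ball (orient o (s + 1 + 1)) (rdim (B (s + 1 + 1))) c'
    (r' + `|(s' - (s + 1 + 1))%R|%N)%N.
  have := sink_ball_down (orbit_dim oB) n_ge3 `|(s' - (s + 1 + 1))%R|%N sb'.
  by rewrite (_ : s' - _%:Z = s + 1 + 1) //; lia.
have ras (E : int -> rep k n) (oE : orbit o E) j :
    exists t : cochain (E j) (E (j + 1 + 1)), right_almost_split (orient o j) t.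
  by have L2 := oE (j + 1); rewrite orientS in L2; apply: linked_right_almost_split (oE j) L2.
have o2 j : orient o (j + 1 + 1) = orient o j by rewrite !orientS negbK.
apply: (sink_ball_step n_ge3 (orbit_dim oA) (orbit_dim oB) _ _ _ sb nsb sb2).
- move=> j x; have [t tr] := ras _ oA j; have [g ig] := irrj (j + 1 + 1).
  have mA := orbit_module (j + 1 + 1) oA; have mB := orbit_module (j + 1 + 1) oB.
  have iA := orbit_indecomposable (j + 1 + 1) oA; rewrite o2 in mA mB iA ig.
  exact: (irreducible_from_dim (orbit_module j oA) mA iA mB tr ig).
- move=> j x; have [t tr] := ras _ oB j; have [g ig] := irrj j.
  have mB := orbit_module (j + 1 + 1) oB.
  have iB := orbit_indecomposable (j + 1 + 1) oB; rewrite o2 in mB iB.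
  have [H _] := irreducible_to (orbit_module j oB) mB iB (orbit_module j oA)
    (orbit_indecomposable j oA) tr ig.
  by move/H => [|]; [right|left].
- have [g ig] := irrj s; have [hg _ _ _] := ig.
  case: (irreducible_monic_or_epic (orbit_module s oA) (orbit_module s oB) ig) => [mg|eg].
    left; split=> x; first by move=> nx; apply: monic_dim mg nx.
    have [g1 hg1 c1] := hom_up (oA s) (oB s) hg.
    have [_ mA1 _ sA1] := linked_strict (oA s).
    have m1 := monic_up mA1 sA1 hg1 c1 mg.
    rewrite -orientS in hg1; have [g2 hg2 c2] := hom_up (oA (s + 1)) (oB (s + 1)) hg1.
    have [_ mA2 _ sA2] := linked_strict (oA (s + 1)).
    by move=> nx; apply: monic_dim (monic_up mA2 sA2 hg2 c2 m1) nx.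
  by right=> x nx; apply: epic_dim eg nx.
Qed.

End Supports.


Theorem theorem3 (k : fieldType) (n : nat) (hn : (3 <= n)%N) (o : bool)
    (M M' : rep k n) (f : mor M M') :
  is_module o M -> is_module o M' ->
  indecomposable o M -> indecomposable o M' ->
  regular o M -> regular o M' ->
  irreducible o f ->
  forall t t' : int, index_is o M t -> index_is o M' t' -> t' = t - 1.
Proof.
move=> mM mM' iM iM' rM rM' irr t t' tM tM'.
have [c [r [sb nsb]]] := index_last_sink hn mM iM rM tM.
have [c' [r' [sb' nsb']]] := index_last_sink hn mM' iM' rM' tM'.
have oA := sig_pow_orbit mM iM rM; have oB := sig_pow_orbit mM' iM' rM'.
have le1 : - t' <= - t + 1 := orbit_index_le hn oA oB irr sb nsb sb'.
have oB2 := orbit_shift2 oB.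
have [g irrg] : exists g : mor (sig_pow o (0 + 1 + 1) M') M, irreducible o g.
  have o0 : orient o 0 = o by case: (o).
  have o1 : orient o (0 + 1) = ~~ o by rewrite orientS o0.
  have o2 : orient o (0 + 1 + 1) = o by rewrite orientS o1 negbK.
  have L1 := oB 0; have L2 := oB (0 + 1); rewrite o0 in L1; rewrite o1 in L2.
  have [u ur] := linked_right_almost_split L1 L2.
  have mB := orbit_module (0 + 1 + 1) oB; have iB := orbit_indecomposable (0 + 1 + 1) oB.
  rewrite o2 in mB iB.
  by have [] := irreducible_to mM' mB iB mM iM ur irr.
(* The orbit [oB2] starts at the double shift of [M'], so its last sink position is two less than
   that of [M'], which is [- t']. *)
have eqt : - t' - 1 - 1 + 1 + 1 = - t' :> int by lia.
have oE : orient o (- t' - 1 - 1) = orient o (- t') by rewrite -{2}eqt !orientS negbK.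
have le2 : - t <= - t' - 1 - 1 + 1.
  apply: (orbit_index_le (s := - t' - 1 - 1) (c := c') (r := r') hn oB2 oA irrg _ _ sb).
  - by rewrite oE eqt.
  - move=> c1 r1; rewrite orientS oE -orientS.
    by rewrite (_ : - t' - 1 - 1 + 1 + 1 + 1 = - t' + 1) //; lia.
lia.
Qed.
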